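(* Let $(R,\mathfrak m)$ be a commutative Noetherian local ring, let $I$ and $J$ be ideals of $R$, let $M$ be an $R$-module, and let $s$ and $t$ be integers. Then: (i) $$\mu^t(M)\leq\sum_{i=0}^{t}\mu^{t-i}(H^{i}_{I,J}(M)).$$ (ii) $$\mu^s(H^{t}_{I,J}(M))\leq \sum_{i=0}^{t-1}\mu^{s+t+1-i}(H^{i}_{I,J}(M))+\mu^{s+t}(M)+\sum_{i=t+1}^{s+t-1}\mu^{s+t-1-i}(H^{i}_{I,J}(M)).$$
   Context: Rings are commutative Noetherian with nonzero identity; modules are not assumed finitely generated. Let $W(I,J)=\{\mathfrak p\in\operatorname{Spec}(R): I^n\subseteq J+\mathfrak p \text{ for some positive integer } n\}$. For an $R$-module $M$, $\Gamma_{I,J}(M)=\{x\in M:\operatorname{Supp}_R(Rx)\subseteq W(I,J)\}$ is the $(I,J)$-torsion submodule of $M$. The functor $\Gamma_{I,J}(-)$ is a covariant $R$-linear functor from $R$-modules to $R$-modules, and $H^i_{I,J}(-)$ denotes its $i$-th right derived functor (the $i$-th local cohomology functor with respect to $(I,J)$). For a prime $\mathfrak p$ with residue field $k(\mathfrak p)=R_{\mathfrak p}/\mathfrak pR_{\mathfrak p}$, the Bass numbers of an $R$-module $X$ are $\mu^j(\mathfrak p,X)=\dim_{k(\mathfrak p)}\operatorname{Ext}^j_{R_{\mathfrak p}}(k(\mathfrak p),X_{\mathfrak p})$ (possibly infinite). When $(R,\mathfrak m)$ is local, $\mu^j(X):=\mu^j(\mathfrak m,X)$. Ext modules and local cohomology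 modules in negative degrees are zero, and empty sums are zero.
   Formalization: Part (i) is proved under the added assumption that I is proper or J = R; it fails otherwise (R = M = k a field, I = R, J = 0, t = 0: all H^i_{I,J}(M) vanish but μ^0(M) = 1). Part (ii) is proved for all I and J. *)

(* Defs.v *)
From HB Require Import structures.
From mathcomp Require Import all_boot all_algebra generic_quotient ring_quotient ring.
From mathcomp Require Import boolp classical_sets functions cardinality.

Set Implicit Arguments.
Unset Strict Implicit.
Unset Printing Implicit Defensive.

Import GRing.Theory.
Local Open Scope ring_scope.
Local Open Scope quotient_scope.

(* Ideals, possibly improper, are the submodules of the regular module.       *)
(* MathComp's [idealr] and [prime_idealr] are the proper and prime ones.      *)
Definition ideal (R : comNzRingType) := submodClosed R^o.

Definition noetherian (R : comNzRingType) : Prop :=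
  forall I : ideal R, exists (n : nat) (g : 'I_n -> R),
    forall x : R, x \in I <-> exists c : 'I_n -> R, x = \sum_i c i * g i.

Definition maximal_ideal (R : comNzRingType) (m : idealr R) : Prop :=
  forall N : idealr R, {subset m <= N} -> N =i m.

(* [m] is given as a prime ideal so that one can localize at it; maximal      *)
(* ideals being prime, this is no restriction.                                *)
Definition local_ring (R : comNzRingType) (m : prime_idealr R) : Prop :=
  maximal_ideal m /\ forall n : idealr R, maximal_ideal n -> n =i m.

Section Submodules.
Variables (R : nzRingType) (V : lmodType R) (N : submodClosed V).

Definition submod : Type := {x : V | x \in N}.

HB.instance Definition _ := [isSub of submod for @sval V (fun x => x \in N)].
HB.instance Definition _ := [Choice of submod by <:].
HB.instance Definition _ := [SubChoice_isSubLmodule of submod by <:].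

(* For lmodules MathComp derives opposite-closure from a submodule only when  *)
(* the predicate is declared with [isSubmodClosed].                           *)
Definition zsubmod : {pred V} := [pred x | x \in N].

HB.instance Definition _ :=
  GRing.isSubmodClosed.Build R V zsubmod (submodClosedP N).

Definition quotmod : Type := Quotient.quot zsubmod.

HB.instance Definition _ := GRing.Zmodule.on quotmod.

Definition to_quot : V -> quotmod := \pi_(Quotient.quot zsubmod).

Definition quot_scale (a : R) (x : quotmod) : quotmod :=
  to_quot (a *: repr (x : Quotient.quot zsubmod)).

Lemma to_quotP z : exists x, z = to_quot x.
Proof. by exists (repr (z : Quotient.quot zsubmod)); rewrite /to_quot reprK. Qed.

Lemma to_quotD : {morph to_quot : x y / x + y}.
Proof. exact: pi_addr. Qed.

Lemma to_quot_eq x y : to_quot x = to_quot y <-> x - y \in N.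
Proof.
have -> : (x - y \in N) = (x - y \in zsubmod) by [].
by rewrite Quotient.idealrBE; split=> [/eqP|/eqP].
Qed.

Lemma quot_scaleE a x : quot_scale a (to_quot x) = to_quot (a *: x).
Proof.
apply/to_quot_eq; rewrite -scalerBr; apply: rpredZ.
by apply/to_quot_eq; rewrite /to_quot reprK.
Qed.

Lemma quot_scaleA a b x : quot_scale a (quot_scale b x) = quot_scale (a * b) x.
Proof. by have [y ->] := to_quotP x; rewrite !quot_scaleE scalerA. Qed.

Lemma quot_scale1 : left_id 1 quot_scale.
Proof. by move=> x; have [y ->] := to_quotP x; rewrite quot_scaleE scale1r. Qed.

Lemma quot_scaleDr : right_distributive quot_scale +%R.
Proof.
move=> a x y; have [x' ->] := to_quotP x; have [y' ->] := to_quotP y.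
by rewrite -to_quotD !quot_scaleE scalerDr to_quotD.
Qed.

Lemma quot_scaleDl x : {morph quot_scale^~ x : a b / a + b}.
Proof.
by move=> a b; have [y ->] := to_quotP x; rewrite !quot_scaleE scalerDl to_quotD.
Qed.

HB.instance Definition _ := GRing.Zmodule_isLmodule.Build R quotmod
  quot_scaleA quot_scale1 quot_scaleDr quot_scaleDl.

End Submodules.

Section Homology.
Variables (R : nzRingType) (U V W : lmodType R).
Variables (f : {linear U -> V}) (g : {linear V -> W}).

Definition ker_pred : {pred V} := [pred x | g x == 0].

Lemma ker_submod : submod_closed ker_pred.
Proof.
split=> [|a x y]; rewrite !inE ?linear0 // => /eqP gx /eqP gy.
by rewrite linearP gx gy scaler0 addr0.
Qed.

HB.instance Definition _ := GRing.isSubmodClosed.Build R V ker_pred ker_submod.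

Definition bnd_pred : {pred submod ker_pred} :=
  [pred z : submod ker_pred | `[< exists u, val z = f u >]].

Lemma bnd_submod : submod_closed bnd_pred.
Proof.
split=> [|a x y]; rewrite !inE; first by exists 0; rewrite !linear0.
move=> [u xu] [v yv]; exists (a *: u + v).
by rewrite !linearP /= xu yv.
Qed.

HB.instance Definition _ :=
  GRing.isSubmodClosed.Build R (submod ker_pred) bnd_pred bnd_submod.

(* ker g / (ker g \cap im f) *)
Definition homology : lmodType R := quotmod bnd_pred.

End Homology.

Section DerivedFunctors.

Record additive_functor (R S : nzRingType) := AdditiveFunctor {
  fobj :> lmodType R -> lmodType S;
  fmap : forall U V : lmodType R, {linear U -> V} -> {linear fobj U -> fobj V};
  fmap_id : forall U : lmodType R, fmap (idfun : {linear U -> U}) =1 id;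
  fmap_comp : forall (U V W : lmodType R)
      (g : {linear V -> W}) (f : {linear U -> V}),
    fmap (g \o f : {linear U -> W}) =1 fmap g \o fmap f;
  fmap_add : forall (U V : lmodType R) (f g : {linear U -> V}),
    fmap (f \+ g : {linear U -> V}) =1 fmap f \+ fmap g
}.

Definition injective_module (R : nzRingType) (E : lmodType R) : Prop :=
  forall (A B : lmodType R) (i : {linear A -> B}) (f : {linear A -> E}),
    injective i -> exists g : {linear B -> E}, forall a, g (i a) = f a.

Record injective_resolution (R : nzRingType) (M : lmodType R) :=
  InjectiveResolution {
    res_obj : nat -> lmodType R;
    res_d : forall n, {linear res_obj n -> res_obj n.+1};
    res_aug : {linear M -> res_obj 0};
    res_inj : forall n, injective_module (res_obj n);
    res_aug_inj : injective res_aug;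
    res_exact0 : forall x, res_d 0 x = 0 <-> exists y, x = res_aug y;
    res_exact : forall n x, res_d n.+1 x = 0 <-> exists y, x = res_d n y
  }.

Variables (R S : nzRingType) (F : additive_functor R S).

Definition applied_cohomology (M : lmodType R) (E : injective_resolution M)
    (n : nat) : lmodType S :=
  match n with
  | 0 => homology (\0 : {linear F (res_obj E 0) -> F (res_obj E 0)})
                  (fmap F (res_d E 0))
  | k.+1 => homology (fmap F (res_d E k)) (fmap F (res_d E k.+1))
  end.

(* The resolution is picked by choice. The [right] branch is a junk value:    *)
(* every module has an injective resolution.                                  *)
Definition right_derived (i : int) (M : lmodType R) : lmodType S :=
  match i with
  | Posz n =>
      match pselect $| injective_resolution M | with
      | left E => applied_cohomology (unsquash E) n
      | right _ => 'rV[S]_0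
      end
  | Negz _ => 'rV[S]_0
  end.

End DerivedFunctors.

Section Hom.
Variables (S : comNzRingType) (n : idealr S).

Definition residue : Type := Quotient.quot n.

HB.instance Definition _ := GRing.ComNzRing.on residue.

Definition to_residue : S -> residue := \pi_(Quotient.quot n).

Lemma to_residueD : {morph to_residue : a b / a + b}.
Proof. exact: pi_addr. Qed.

Lemma to_residueM : {morph to_residue : a b / a * b}.
Proof. exact: pi_mulr. Qed.

Lemma to_residue1 : to_residue 1 = 1.
Proof. exact: pi_oner. Qed.

Definition residue_scale (a : S) (x : residue) : residue := to_residue a * x.

Lemma residue_scaleA a b x :
  residue_scale a (residue_scale b x) = residue_scale (a * b) x.
Proof. by rewrite /residue_scale to_residueM mulrA. Qed.

Lemma residue_scale1 : left_id 1 residue_scale.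
Proof. by move=> x; rewrite /residue_scale to_residue1 mul1r. Qed.

Lemma residue_scaleDr : right_distributive residue_scale +%R.
Proof. by move=> a x y; rewrite /residue_scale mulrDr. Qed.

Lemma residue_scaleDl x : {morph residue_scale^~ x : a b / a + b}.
Proof. by move=> a b; rewrite /residue_scale to_residueD mulrDl. Qed.

HB.instance Definition _ := GRing.Zmodule_isLmodule.Build S residue
  residue_scaleA residue_scale1 residue_scaleDr residue_scaleDl.

Lemma residue_scaleE (a : S) (x : residue) : a *: x = to_residue a * x.
Proof. by []. Qed.

Definition hom_pred (X : lmodType S) : {pred (residue -> X)} :=
  [pred f : residue -> X | `[< linear f >]].

Lemma hom_submod X : submod_closed (@hom_pred X).
Proof.
split=> [|c f g]; rewrite !inE.
  by move=> a x y; rewrite scaler0 addr0.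
move=> lf lg a x y.
have E z : (c *: f + g) z = c *: f z + g z by [].
by rewrite !E lf lg !scalerDr !scalerA mulrC addrACA.
Qed.

HB.instance Definition _ (X : lmodType S) :=
  GRing.isSubmodClosed.Build S (residue -> X) (@hom_pred X) (@hom_submod X).

Definition hom_residue (X : lmodType S) : Type := submod (@hom_pred X).

HB.instance Definition _ (X : lmodType S) := GRing.Zmodule.on (hom_residue X).

Lemma homP (X : lmodType S) (f : hom_residue X) : linear (val f : residue -> X).
Proof. by have := valP f; rewrite !inE. Qed.

Lemma hom_eq (X : lmodType S) (f g : hom_residue X) : (forall x, val f x = val g x) -> f = g.
Proof. by move=> fg; apply/val_inj/funext. Qed.

Lemma hom_valD (X : lmodType S) (f g : hom_residue X) x : val (f + g) x = val f x + val g x.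
Proof. by []. Qed.

Lemma hom_scale_subproof X (c : residue) (f : hom_residue X) :
  (fun x => val f (c * x)) \in @hom_pred X.
Proof.
rewrite inE => a x y; rewrite -(homP f); congr (val f _).
by rewrite mulrDr !residue_scaleE mulrCA.
Qed.

(* Hom_S(S/n, X) as a module over S/n, which acts on the source.              *)
Definition hom_scale X (c : residue) (f : hom_residue X) : hom_residue X :=
  Sub (fun x => val f (c * x)) (hom_scale_subproof c f).

Lemma hom_scaleA X (a b : residue) (f : hom_residue X) :
  hom_scale a (hom_scale b f) = hom_scale (a * b) f.
Proof. by apply: hom_eq => x; rewrite !SubK mulrA (mulrC b). Qed.

Lemma hom_scale1 X : left_id 1 (@hom_scale X).
Proof. by move=> f; apply: hom_eq => x; rewrite !SubK mul1r. Qed.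

Lemma hom_scaleDr X : right_distributive (@hom_scale X) +%R.
Proof. by move=> a f g; apply: hom_eq => x; rewrite hom_valD !SubK. Qed.

Lemma hom_scaleDl X (f : hom_residue X) :
  {morph (@hom_scale X)^~ f : a b / a + b}.
Proof.
move=> a b; apply: hom_eq => x; rewrite hom_valD !SubK mulrDl.
by have := homP f 1 (a * x) (b * x); rewrite !scale1r.
Qed.

HB.instance Definition _ (X : lmodType S) := GRing.Zmodule_isLmodule.Build residue
  (hom_residue X) (@hom_scaleA X) (@hom_scale1 X) (@hom_scaleDr X)
  (@hom_scaleDl X).

Section HomMap.
Variables (X Y : lmodType S) (h : {linear X -> Y}).

Lemma hom_map_subproof (f : hom_residue X) : h \o val f \in @hom_pred Y.
Proof. by rewrite inE => a x y; rewrite /= homP linearP. Qed.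

Definition hom_map (f : hom_residue X) : hom_residue Y :=
  Sub (h \o val f) (hom_map_subproof f).

Lemma hom_map_linear : linear hom_map.
Proof. by move=> c f g; apply: hom_eq => x; rewrite !SubK /= linearD. Qed.

HB.instance Definition _ :=
  GRing.isLinear.Build residue (hom_residue X) (hom_residue Y) _ hom_map
    hom_map_linear.
End HomMap.

Definition hom_functor : additive_functor S residue.
Proof.
refine (@AdditiveFunctor S residue (fun X => hom_residue X)
          (fun U V f => hom_map f) _ _ _).
- by move=> U f; apply: hom_eq.
- by move=> U V W g h f; apply: hom_eq.
- by move=> U V g h f; apply: hom_eq.
Defined.

(* Ext^j_S(S/n, X) as an S/n-module.                                          *)
Definition Ext_residue (j : int) (X : lmodType S) : lmodType residue :=
  right_derived hom_functor j X.

End Hom.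

Section Localization.
Variables (R : comNzRingType) (p : prime_idealr R).

Definition denom : Type := {s : R | s \notin p}.

HB.instance Definition _ := [isSub of denom for @sval R (fun s => s \notin p)].
HB.instance Definition _ := [Choice of denom by <:].

Lemma denom1_subproof : 1 \notin p. Proof. by rewrite idealr1. Qed.
Definition denom1 : denom := Sub 1 denom1_subproof.

Lemma denomM_subproof (s t : denom) : val s * val t \notin p.
Proof. by rewrite prime_idealrM negb_or (valP s) (valP t). Qed.
Definition denomM (s t : denom) : denom :=
  Sub (val s * val t) (denomM_subproof s t).

Section LocalizedModule.
Variable X : lmodType R.

Definition frac_rel (a b : X * denom) : bool :=
  `[< exists u : denom, (val u * val b.2) *: a.1 = (val u * val a.2) *: b.1 >].

Lemma frac_rel_equiv : equiv_class_of frac_rel.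
Proof.
split=> [a|a b|b a c].
- by apply/asboolP; exists denom1.
- by apply/asboolP/asboolP => -[u e]; exists u.
move=> /asboolP[u e1] /asboolP[v e2]; apply/asboolP.
exists (denomM (denomM u v) (b.2 : denom)); rewrite !SubK.
have -> : val u * val v * val b.2 * val c.2
        = val v * val c.2 * (val u * val b.2) by ring.
rewrite -scalerA e1 scalerA.
have -> : val v * val c.2 * (val u * val a.2)
        = val u * val a.2 * (val v * val c.2) by ring.
by rewrite -scalerA e2 scalerA; congr (_ *: _); ring.
Qed.

Canonical frac_equiv := EquivRelPack frac_rel_equiv.
Canonical frac_encModRel := defaultEncModRel frac_rel.

Definition locmod : Type := {eq_quot frac_rel}.

HB.instance Definition _ := Choice.on locmod.

Definition frac (x : X) (s : denom) : locmod := \pi_({eq_quot frac_rel}) (x, s).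
Definition num (z : locmod) : X := (repr z).1.
Definition den (z : locmod) : denom := (repr z).2.

Lemma frac_eq x s y t : frac x s = frac y t <->
  exists u : denom, (val u * val t) *: x = (val u * val s) *: y.
Proof.
split=> [/eqP|e]; first by rewrite piE => /asboolP.
by apply/eqP; rewrite piE; apply/asboolP.
Qed.

Lemma fracK z : frac (num z) (den z) = z.
Proof. by rewrite /frac -surjective_pairing reprK. Qed.

Lemma fracP z : exists x s, z = frac x s.
Proof. by exists (num z), (den z); rewrite fracK. Qed.

Lemma num_frac x s : exists u : denom,
  (val u * val s) *: num (frac x s) = (val u * val (den (frac x s))) *: x.
Proof. by apply/frac_eq; rewrite fracK. Qed.

Definition loc_add (y z : locmod) : locmod :=
  frac (val (den z) *: num y + val (den y) *: num z) (denomM (den y) (den z)).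
Definition loc_opp (z : locmod) : locmod := frac (- num z) (den z).
Definition loc_zero : locmod := frac 0 denom1.

Lemma loc_addE x s y t : loc_add (frac x s) (frac y t) =
  frac (val t *: x + val s *: y) (denomM s t).
Proof.
have [u e1] := num_frac x s; have [v e2] := num_frac y t.
rewrite /loc_add; move: (num _) (den _) (num (frac y t)) (den (frac y t)) e1 e2.
move=> x' s' y' t' e1 e2; apply/frac_eq; exists (denomM u v); rewrite !SubK.
rewrite !scalerDr !scalerA; congr (_ + _).
  have -> : val u * val v * (val s * val t) * val t'
          = val v * val t * val t' * (val u * val s) by ring.
  by rewrite -scalerA e1 scalerA; congr (_ *: _); ring.
have -> : val u * val v * (val s * val t) * val s'
        = val u * val s * val s' * (val v * val t) by ring.
by rewrite -scalerA e2 scalerA; congr (_ *: _); ring.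
Qed.

Lemma loc_oppE x s : loc_opp (frac x s) = frac (- x) s.
Proof.
have [u e] := num_frac x s; apply/frac_eq; exists u.
by rewrite !scalerN e.
Qed.

Lemma loc_addA : associative loc_add.
Proof.
move=> z1 z2 z3; have [x [s ->]] := fracP z1; have [y [t ->]] := fracP z2.
have [w [r ->]] := fracP z3; rewrite !loc_addE; apply/frac_eq; exists denom1.
rewrite !SubK !scalerDr !scalerA -!addrA.
by congr (_ *: _ + (_ *: _ + _ *: _)); ring.
Qed.

Lemma loc_addC : commutative loc_add.
Proof.
move=> z1 z2; have [x [s ->]] := fracP z1; have [y [t ->]] := fracP z2.
rewrite !loc_addE; apply/frac_eq; exists denom1; rewrite !SubK addrC.
by congr (_ *: _); ring.
Qed.

Lemma loc_add0 : left_id loc_zero loc_add.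
Proof.
move=> z; have [x [s ->]] := fracP z; rewrite loc_addE; apply/frac_eq.
by exists denom1; rewrite !SubK scaler0 add0r scalerA; congr (_ *: _); ring.
Qed.

Lemma loc_addN : left_inverse loc_zero loc_opp loc_add.
Proof.
move=> z; have [x [s ->]] := fracP z; rewrite loc_oppE loc_addE; apply/frac_eq.
by exists denom1; rewrite scalerN addNr !scaler0.
Qed.

HB.instance Definition _ :=
  GRing.isZmodule.Build locmod loc_addA loc_addC loc_add0 loc_addN.

Lemma fracD x s y t :
  frac x s + frac y t = frac (val t *: x + val s *: y) (denomM s t).
Proof. exact: loc_addE. Qed.

End LocalizedModule.

Definition loc : Type := locmod R^o.

HB.instance Definition _ := GRing.Zmodule.on loc.

Definition loc_frac (a : R) (s : denom) : loc := frac (a : R^o) s.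

Lemma loc_fracP (a : loc) : exists b s, a = loc_frac b s.
Proof. exact: (@fracP R^o a). Qed.

Lemma loc_fracD a s b t :
  loc_frac a s + loc_frac b t = loc_frac (val t * a + val s * b) (denomM s t).
Proof. exact: (@fracD R^o a s b t). Qed.

Section Action.
Variable X : lmodType R.

Definition loc_scale (a : loc) (z : locmod X) : locmod X :=
  frac ((num a : R) *: num z) (denomM (den a) (den z)).

Lemma loc_scaleE a s (x : X) t :
  loc_scale (loc_frac a s) (frac x t) = frac (a *: x) (denomM s t).
Proof.
have [u e1] := num_frac (a : R^o) s; have [v e2] := num_frac x t.
rewrite /loc_scale /loc_frac.
move: (num _) (den _) (num (frac x t)) (den (frac x t)) e1 e2.
move=> a' s' x' t' e1 e2; apply/frac_eq; exists (denomM u v); rewrite !SubK.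
have {}e1 : val u * val s * (a' : R) = val u * val s' * a by exact: e1.
rewrite !scalerA.
have -> : val u * val v * (val s * val t) * (a' : R)
        = val u * val s * (a' : R) * (val v * val t) by ring.
rewrite -scalerA e2 scalerA e1; congr (_ *: _); ring.
Qed.

Lemma loc_scale1 (z : locmod X) : loc_scale (loc_frac 1 denom1) z = z.
Proof.
have [x [t ->]] := fracP z; rewrite loc_scaleE scale1r; apply/frac_eq.
by exists denom1; rewrite !SubK !mul1r.
Qed.

Lemma loc_scaleDr : right_distributive loc_scale +%R.
Proof.
move=> c y z; have [a [r ->]] := loc_fracP c; have [x [s ->]] := fracP y.
have [w [t ->]] := fracP z; rewrite fracD !loc_scaleE fracD; apply/frac_eq.
exists denom1; rewrite !SubK !scalerDr !scalerA.
by congr (_ *: _ + _ *: _); ring.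
Qed.

Lemma loc_scaleDl (z : locmod X) : {morph loc_scale^~ z : a b / a + b}.
Proof.
move=> c d /=; have [a [r ->]] := loc_fracP c; have [b [s ->]] := loc_fracP d.
have [x [t ->]] := fracP z; rewrite loc_fracD !loc_scaleE fracD; apply/frac_eq.
exists denom1; rewrite !SubK !scalerDr !scalerA -scalerDl.
by congr (_ *: _); ring.
Qed.

End Action.

Definition loc_mul (a b : loc) : loc := loc_scale a b.

Lemma loc_mulE a s b t :
  loc_mul (loc_frac a s) (loc_frac b t) = loc_frac (a * b) (denomM s t).
Proof. exact: loc_scaleE. Qed.

Lemma loc_scaleA (X : lmodType R) a b (z : locmod X) :
  loc_scale a (loc_scale b z) = loc_scale (loc_mul a b) z.
Proof.
have [c [r ->]] := loc_fracP a; have [d [s ->]] := loc_fracP b.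
have [x [t ->]] := fracP z; rewrite loc_mulE !loc_scaleE scalerA.
by apply/frac_eq; exists denom1; rewrite !SubK; congr (_ *: _); ring.
Qed.

Lemma loc_mulA : associative loc_mul.
Proof. by move=> a b c; rewrite /loc_mul loc_scaleA. Qed.

Lemma loc_mulC : commutative loc_mul.
Proof.
move=> a b; have [c [r ->]] := loc_fracP a; have [d [s ->]] := loc_fracP b.
rewrite !loc_mulE mulrC; apply/frac_eq; exists denom1; rewrite !SubK.
by congr (_ *: _); ring.
Qed.

Lemma loc_mul1 : left_id (loc_frac 1 denom1) loc_mul.
Proof. exact: loc_scale1. Qed.

Lemma loc_mulDl : left_distributive loc_mul +%R.
Proof. by move=> a b c; exact: loc_scaleDl. Qed.

Lemma loc_1neq0 : loc_frac 1 denom1 != 0.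
Proof.
apply/eqP => /frac_eq[u]; rewrite scaler0 => /eqP.
rewrite -[_ *: _]/(val u * 1 * 1) !mulr1 => /eqP u0.
by have := valP u; rewrite u0 rpred0.
Qed.

HB.instance Definition _ := GRing.Zmodule_isComNzRing.Build loc
  loc_mulA loc_mulC loc_mul1 loc_mulDl loc_1neq0.

HB.instance Definition _ (X : lmodType R) := GRing.Zmodule_isLmodule.Build loc
  (locmod X) (@loc_scaleA X) (@loc_scale1 X) (@loc_scaleDr X) (@loc_scaleDl X).

(* The ideal pR_p.                                                            *)
Definition loc_max : {pred loc} :=
  [pred z : loc | `[< exists (a : R) (s : denom), a \in p /\ z = loc_frac a s >]].

Lemma loc_max_closed : idealr_closed loc_max.
Proof.
split; rewrite ?inE.
- by exists 0, denom1; split; rewrite ?rpred0.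
- apply/negP; rewrite inE => -[a [s [pa /frac_eq[u e]]]].
  have {}e : val u * val s * 1 = val u * 1 * a by exact: e.
  have : val u * val s \in p by rewrite -[_ * _]mulr1 e idealMr.
  by rewrite (negPf (denomM_subproof u s)).
move=> c y z; rewrite !inE => -[a [s [pa ->]]] [b [t [pb ->]]].
have [d [r ->]] := loc_fracP c.
exists (val t * (d * a) + val (denomM r s) * b), (denomM (denomM r s) t).
split; first by rewrite rpredD // !idealMr.
by rewrite -loc_fracD -loc_mulE.
Qed.

HB.instance Definition _ := isIdealr.Build loc loc_max loc_max_closed.

End Localization.

Section LocalCohomology.
Variable R : comNzRingType.

Definition Supp (X : lmodType R) (p : prime_idealr R) : Prop :=
  exists z : locmod p X, z != 0.

(* I^n: the R-linear combinations of n-fold products of elements of I.        *)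
Definition ideal_exp (I : ideal R) (n : nat) (x : R) : Prop :=
  exists (k : nat) (c : 'I_k -> R) (f : 'I_k -> 'I_n -> R),
    (forall i j, f i j \in I) /\ x = \sum_i c i * \prod_j f i j.

Definition W (I J : ideal R) (p : prime_idealr R) : Prop :=
  exists2 n, (0 < n)%N & forall x, ideal_exp I n x ->
    exists a b, [/\ a \in J, b \in p & x = a + b].

Section Cyclic.
Variables (M : lmodType R) (x : M).

Definition cyclic_pred : {pred M} := [pred y | `[< exists a : R, y = a *: x >]].

Lemma cyclic_submod : submod_closed cyclic_pred.
Proof.
split=> [|a y z]; rewrite !inE; first by exists 0; rewrite scale0r.
by move=> [b ->] [c ->]; exists (a * b + c); rewrite scalerDl scalerA.
Qed.

HB.instance Definition _ :=
  GRing.isSubmodClosed.Build R M cyclic_pred cyclic_submod.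

Definition cyclic : lmodType R := submod cyclic_pred.

Lemma Supp_cyclic p :
  ~ Supp cyclic p <-> exists u : denom p, val u *: x = 0.
Proof.
have xP : x \in cyclic_pred by rewrite inE; exists 1; rewrite scale1r.
pose x1 : cyclic := Sub x xP.
split=> [px|[u ux] [z]].
  have : frac (p := p) x1 (denom1 p) = 0.
    by apply/eqP/negPn/negP => ?; apply: px; exists (frac x1 (denom1 p)).
  move=> /frac_eq[u /(congr1 val)]; rewrite scaler0 /= => u0.
  by exists u; rewrite -[val u]mulr1.
have [y [s ->]] := fracP z => /eqP; apply; apply/frac_eq; exists u.
rewrite scaler0; apply: val_inj => /=.
have := valP y; rewrite inE => -[a ->].
by rewrite !scalerA -mulrA mulrC -scalerA ux scaler0.
Qed.

End Cyclic.

Section Gamma.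
Variables I J : ideal R.

Definition Gamma_pred (M : lmodType R) : {pred M} :=
  [pred x | `[< forall p, Supp (cyclic x) p -> W I J p >]].

Lemma Gamma_submod M : submod_closed (@Gamma_pred M).
Proof.
split=> [|a x y]; rewrite !inE.
  by move=> p p0; exfalso; apply: (iffRL (Supp_cyclic 0 p)) p0;
     exists (denom1 p); rewrite scaler0.
move=> Wx Wy p pxy; apply: contrapT => Wp.
have /Supp_cyclic[u ux] : ~ Supp (cyclic x) p by move=> /Wx.
have /Supp_cyclic[v vy] : ~ Supp (cyclic y) p by move=> /Wy.
apply: (iffRL (Supp_cyclic (a *: x + y) p)) pxy; exists (denomM u v).
rewrite SubK scalerDr -[_ *: y]scalerA vy !scaler0 addr0 scalerA.
have -> : val u * val v * a = val v * a * val u by ring.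
by rewrite -scalerA ux scaler0.
Qed.

HB.instance Definition _ (M : lmodType R) :=
  GRing.isSubmodClosed.Build R M (@Gamma_pred M) (@Gamma_submod M).

Definition Gamma (M : lmodType R) : Type := submod (@Gamma_pred M).

HB.instance Definition _ (M : lmodType R) := GRing.Lmodule.on (Gamma M).

Section GammaMap.
Variables (M N : lmodType R) (f : {linear M -> N}).

Lemma Gamma_map_subproof (x : Gamma M) : f (val x) \in @Gamma_pred N.
Proof.
have := valP x; rewrite !inE => Wx p pfx; apply: Wx; apply: contrapT.
move=> /Supp_cyclic[u ux]; apply: (iffRL (Supp_cyclic (f (val x)) p)) pfx.
by exists u; rewrite -linearZ ux linear0.
Qed.

Definition Gamma_map (x : Gamma M) : Gamma N :=
  Sub (f (val x)) (Gamma_map_subproof x).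

Lemma Gamma_map_linear : linear Gamma_map.
Proof. by move=> a x y; apply: val_inj; rewrite /= !linearP. Qed.

HB.instance Definition _ :=
  GRing.isLinear.Build R (Gamma M) (Gamma N) _ Gamma_map Gamma_map_linear.

End GammaMap.

Definition Gamma_functor : additive_functor R R.
Proof.
refine (@AdditiveFunctor R R (fun M => Gamma M)
          (fun U V f => Gamma_map f) _ _ _).
- by move=> U x; apply: val_inj.
- by move=> U V W' g f x; apply: val_inj.
- by move=> U V f g x; apply: val_inj.
Defined.

Definition local_cohomology (i : int) (M : lmodType R) : lmodType R :=
  right_derived Gamma_functor i M.

End Gamma.
End LocalCohomology.

Definition is_basis (K : nzRingType) (V : lmodType K) (B : set V) : Prop :=
  (forall (k : nat) (b : 'I_k -> V) (c : 'I_k -> K),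
     injective b -> (forall i, B (b i)) -> \sum_i c i *: b i = 0 ->
     forall i, c i = 0) /\
  (forall v : V, exists (k : nat) (b : 'I_k -> V) (c : 'I_k -> K),
     (forall i, B (b i)) /\ v = \sum_i c i *: b i).

(* Used for k(p)-modules only, and k(p) is a field, so a basis exists.         *)
(* Cardinal numbers are represented by types, a dimension by (the type of     *)
(* elements of) a basis, so that infinite dimensions keep their cardinality.  *)
Definition dimension (K : nzRingType) (V : lmodType K) : Type :=
  {v : V | xget set0 (@is_basis K V) v}.

(* The Bass number mu^j(p, X) = dim_{k(p)} Ext^j_{R_p}(k(p), X_p).            *)
Definition bass_number (R : comNzRingType) (p : prime_idealr R) (j : int)
    (X : lmodType R) : Type :=
  dimension (Ext_residue (@loc_max R p) j (locmod p X)).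

Definition cardinal_le (A B : Type) : Prop := ([set: A] #<= [set: B])%card.

Definition cardinal_sum (a b : int) (F : int -> Type) : Type :=
  {i : {i : int | a <= i <= b} & F (val i)}.

Arguments cardinal_sum (a b)%_R F.

(* Main.v *)
Require Import Defs.
From HB Require Import structures.
From mathcomp Require Import all_boot all_algebra generic_quotient ring_quotient ring zify.
From mathcomp Require Import boolp classical_sets functions cardinality.

Set Implicit Arguments.
Unset Strict Implicit.
Unset Printing Implicit Defensive.

Import Defs GRing.Theory.
Local Open Scope classical_set_scope.
Local Open Scope ring_scope.

(** Let G = Hom(k, -), with k the residue field, and write h^p X for the dimension
of R^p G X; this is the Bass number mu^p X, because the elements outside m are units and
localizing at m changes nothing ([locP]). Choose an injective resolution E of M,
and let C be the complex of the torsion submodules of the terms of E, whose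
cohomology is H^i = H^i_{I,J}(M). A spectral sequence from h^p H^q to the
cohomology of G C lies behind both inequalities, but counting dimensions along
short exact sequences is enough.

Two facts about torsion are needed. The terms of C are injective, because over a
Noetherian ring the torsion submodule of an injective module is a direct summand
([Gamma_retraction], [Gamma_injective]). And G C = G E, because maps from k have
torsion image as soon as m lies in W I J ([Gamma_residue_bijective]); so the
cohomology of G C has the dimensions mu^t M. The point m fails to lie in W I J only
if I is the unit ideal and J is proper, and then all torsion vanishes and part (ii)
is trivial ([Gamma_zero]).

Let Z^n and B^n be the cycles and boundaries of C. As C^n is injective,
Z^n -> C^n -> B^(n+1) gives h^p B^(n+1) = h^(p+1) Z^n for p > 0, and the long exact
sequence of B^n -> Z^n -> H^n bounds any of its terms by its two neighbours. Going
down in n, h^p Z^n is at most the sum over i <= n of h^(p+n-i) H^i ([ext_le_Z]). Part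
(i) follows because the cohomology of G C in degree n+1 is an extension of a
subspace of G H^(n+1) by R^1 G Z^n ([coh_le_total]). For part (ii),
h^s H^t <= h^(s+1) B^t + h^s Z^t; the first term is bounded by going down, and the
second by going up in n, until one reaches R^1 G Z^(s+t-1), which embeds in the
cohomology of G C in degree s+t ([ext_le_Z_coh], [ext_le_H]).

The dimensions are cardinal numbers. A bound by a type T is expressed by a spanning
family indexed by T ([dim_le]), and an infinite version of the Steinitz exchange
lemma ([exchange]) makes these bounds pass to subspaces and turns them into
injections of bases. The derived functors are defined by a chosen resolution, so
they are compared with those of other resolutions ([coh_le_retract]); the long exact
sequences come from dimension shifting ([ext_le_middle], [ext_le_sub],
[ext_le_quot]). *)

(** * Independence and exchange in vector spaces of any dimension *)
Section Span.
Variables (K : comNzRingType) (V : lmodType K).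
Implicit Types (A B N Z : set V) (x y : V).

Inductive span A : V -> Prop :=
| span0 : span A 0
| span_gen x : A x -> span A x
| span_lin c x y : span A x -> span A y -> span A (c *: x + y).

Lemma spanD A x y : span A x -> span A y -> span A (x + y).
Proof. by move=> Ax Ay; rewrite -[x]scale1r; exact: span_lin. Qed.

Lemma spanZ A c x : span A x -> span A (c *: x).
Proof. by move=> Ax; rewrite -[_ *: _]addr0; apply: span_lin => //; exact: span0. Qed.

Lemma spanB A x y : span A x -> span A y -> span A (x - y).
Proof. by move=> Ax Ay; rewrite addrC -scaleN1r; exact: span_lin. Qed.

Lemma span_trans A B y : (forall a, A a -> span B a) -> span A y -> span B y.
Proof.
move=> AB; elim=> [|x /AB//|c x z _ Bx _ Bz]; [exact: span0|exact: span_lin].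
Qed.

Lemma span_mono A B y : A `<=` B -> span A y -> span B y.
Proof. by move=> AB; apply: span_trans => a /AB; exact: span_gen. Qed.

Lemma span_add1 A w y : span (w |` A) y ->
  exists (u : V) (c : K), span A u /\ y = u + c *: w.
Proof.
elim=> [|x [->|Ax]|c x z _ [u [a [Au ->]]] _ [v [b [Av ->]]]].
- by exists 0, 0; rewrite scale0r addr0; split=> //; exact: span0.
- by exists 0, 1; rewrite scale1r add0r; split=> //; exact: span0.
- by exists x, 0; rewrite scale0r addr0; split=> //; exact: span_gen.
exists (c *: u + v), (c * a + b); split; first exact: span_lin.
by rewrite scalerDr scalerDl scalerA addrACA.
Qed.

Lemma span_uniq A y : span A y -> exists (s : seq V) (c : V -> K),
  [/\ uniq s, forall v, v \in s -> A v & y = \sum_(v <- s) c v *: v].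
Proof.
have ext (s s' : seq V) (c : V -> K) : uniq s -> uniq s' -> {subset s <= s'} ->
    \sum_(v <- s) c v *: v
    = \sum_(v <- s') (if v \in s then c v else 0) *: v.
  move=> us us' ss'; have ps : perm_eq s [seq v <- s' | v \in s].
    apply: uniq_perm => [//||v]; first exact: filter_uniq.
    by rewrite mem_filter; case: (boolP (v \in s)) => // /ss' ->.
  rewrite (perm_big _ ps) /= big_filter [LHS]big_mkcond /=.
  by apply: eq_bigr => v _; case: ifP; rewrite ?scale0r.
elim=> [|x Ax|a x z _ [s [c [us sA ->]]] _ [t [d [ut tA ->]]]].
- by exists [::], (fun=> 0); rewrite big_nil.
- exists [:: x], (fun=> 1); rewrite big_seq1 scale1r; split=> // v.
  by rewrite inE => /eqP ->.
pose r := undup (s ++ t).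
have ur : uniq r by exact: undup_uniq.
exists r, (fun v => a * (if v \in s then c v else 0)
                    + (if v \in t then d v else 0)); split=> //.
  by move=> v; rewrite mem_undup mem_cat => /orP[/sA|/tA].
rewrite (ext s r c) // ?(ext t r d) //.
- rewrite scaler_sumr -big_split /=; apply: eq_bigr => v _.
  by rewrite scalerDl scalerA.
- by move=> v vt; rewrite mem_undup mem_cat vt orbT.
- by move=> v vs; rewrite mem_undup mem_cat vs.
Qed.

(** Independence modulo the subspace spanned by N. An independent family is
injective, since a repeated vector lies in the span of the other ones. *)
Definition indep I N (x : I -> V) :=
  forall i, ~ span (N `|` [set x j | j in [set j | j <> i]]) (x i).

(** The dimension of Z / (N \cap Z), for Z a subspace, is at most the cardinality
of T: a spanning family indexed by T. Writing bounds in this way avoids forming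
the quotient, and T may be any type, so that no cardinal arithmetic is needed. *)
Definition dim_le Z N (T : Type) :=
  exists v : T -> V, (forall t, Z (v t)) /\
    forall y, Z y -> span (N `|` range v) y.

Hypothesis fieldK : forall a : K, a != 0 -> exists b, b * a = 1.

(** The exchange step: if some x j depended on w and the other vectors, one could solve
for w, as its coefficient is invertible when it is nonzero. *)
Lemma indep_step I N (x : I -> V) i w :
  (forall j, j <> i -> ~ span (N `|` [set x l | l in [set l | l <> i /\ l <> j]]) (x j)) ->
  ~ span (N `|` [set x j | j in [set j | j <> i]]) w ->
  indep N (fun j => if pselect (j = i) then w else x j).
Proof.
move=> indx Nw j; case: pselect => [ji|ji] /=.
  rewrite ji; apply: contra_not Nw; apply: span_mono => v [Nv|[l /= li <-]]; first by left.
  by right; exists l => //; case: pselect.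
move=> xj; have : span (w |` (N `|` [set x l | l in [set l | l <> i /\ l <> j]])) (x j).
  apply: span_mono xj => v [Nv|[l /= lj]]; first by right; left.
  by case: pselect => [li|li] /= <-; [left|right; right; exists l].
move=> /span_add1[u [c [Nu xjE]]].
have [c0|c0] := eqVneq c 0.
  by apply: (indx j ji); rewrite xjE c0 scale0r addr0.
have [b bc] := fieldK c0; apply: Nw.
have -> : w = b *: (x j - u) by rewrite xjE addrAC subrr add0r scalerA bc scale1r.
apply/spanZ/spanB; first by apply: span_gen; right; exists j.
by apply: span_mono Nu => v [?|[l [? ?] <-]]; [left|right; exists l].
Qed.

(** Steinitz exchange without finiteness. Zorn's lemma applies to the partial maps
phi from I to T such that replacing x i by v (phi i) wherever phi is defined
keeps the family independent. Independence forces such a phi to be injective,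
and a maximal one is total. *)
Lemma exchange I T N (x : I -> V) (v : T -> V) :
  indep N x -> (forall i, span (N `|` range v) (x i)) ->
  exists f : I -> T, injective f.
Proof.
move=> indx xv.
pose repl (phi : I -> option T) i := if phi i is Some t then v t else x i.
pose X := {phi : I -> option T | indep N (repl phi)}.
pose le (p q : I -> option T) := forall i t, p i = Some t -> q i = Some t.
pose R (p q : X) := `[< le (sval p) (sval q) >].
have [|p q r /asboolP pq /asboolP qr|[p hp] [q hq]|A totA|p maxp] := @Zorn X R.
- by move=> p; apply/asboolP => i t.
- by apply/asboolP => i t /pq /qr.
- move=> /asboolP/= pq /asboolP/= qp; apply: eq_exist => /=; apply: funext => i.
  case pi: (p i) => [t|]; first by rewrite (pq _ _ pi).
  by case qi: (q i) => [t|//]; rewrite (qp _ _ qi) in pi.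
- (* A chain has the common extension of its members as an upper bound. It is
     independent because a dependency involves finitely many indices, at which
     some member of the chain already agrees with it. *)
  pose sup i := if pselect (exists t, exists2 p : X, A p & sval p i = Some t)
                is left h then Some (projT1 (cid h)) else None.
  have supP p i t : A p -> sval p i = Some t -> sup i = Some t.
    move=> Ap pit; rewrite /sup; case: pselect => [h|[]]; last by exists t, p.
    case: (cid h) => t' /= [q Aq qit'].
    by have [/asboolP/(_ _ _ pit)|/asboolP/(_ _ _ qit')] := totA _ _ Ap Aq; congruence.
  have [[p0 Ap0]|A0] := pselect (exists p, A p); last first.
    exists (exist (fun phi => indep N (repl phi)) (fun=> None) indx) => s As.
    by case: A0; exists s.
  have dec i : exists2 p : X, A p & sval p i = sup i.
    case si: (sup i) => [t|].
      move: si; rewrite /sup; case: pselect => // h [<-].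
      by case: (cid h) => t' /= [q Aq qit']; exists q.
    exists p0 => //; case pi: (sval p0 i) => [t|//].
    by rewrite (supP _ _ _ Ap0 pi) in si.
  have stable (p q : X) i : A p -> A q -> R p q -> sval p i = sup i -> sval q i = sup i.
    move=> Ap Aq /asboolP pq pi; case si: (sup i) => [t|].
      by apply: pq; rewrite pi.
    by case qi: (sval q i) => [t|//]; rewrite (supP _ _ _ Aq qi) in si.
  have maxA (p q : X) : A p -> A q -> exists r : X, [/\ A r, R p r & R q r].
    move=> Ap Aq; have Rxx s : R s s by apply/asboolP => ? ?.
    by have [|] := totA _ _ Ap Aq; [exists q|exists p].
  have Rtrans (p q r : X) : R p q -> R q r -> R p r.
    by move=> /asboolP pq /asboolP qr; apply/asboolP => i t /pq /qr.
  have ind : indep N (repl sup).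
    move=> i /= Hspan.
    have fin y : span (N `|` [set repl sup j | j in [set j | j <> i]]) y ->
        exists2 p : X, A p & forall q : X, A q -> R p q ->
        span (N `|` [set repl (sval q) j | j in [set j | j <> i]]) y.
      elim=> [|z [Nz|[j /= ji <-]]|c y1 y2 _ [p Ap hp] _ [q Aq hq]].
      - by exists p0 => // *; exact: span0.
      - by exists p0 => // *; apply: span_gen; left.
      - have [p Ap pj] := dec j; exists p => // q Aq pq.
        by apply: span_gen; right; exists j => //; rewrite /repl (stable p).
      - have [r [Ar pr qr]] := maxA _ _ Ap Aq; exists r => // s As rs.
        by apply: span_lin; [apply: hp|apply: hq] => //; apply: Rtrans rs.
    have [p Ap hp] := fin _ Hspan; have [q Aq qi] := dec i.
    have [r [Ar pr qr]] := maxA _ _ Ap Aq.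
    apply: (proj2_sig r i); have := hp r Ar pr.
    by have -> : repl sup i = repl (sval r) i by rewrite /repl (stable q r).
  exists (exist (fun phi => indep N (repl phi)) sup ind) => p Ap; apply/asboolP => i t /=.
  exact: supP.
(* If x i were not yet replaced in a maximal p, the span of the other vectors
   would miss x i, hence some v t, which could replace x i. *)
have tot i : exists t, sval p i = Some t.
  case pi: (sval p i) => [t|]; first by exists t.
  have [t Nt] : exists t,
      ~ span (N `|` [set repl (sval p) j | j in [set j | j <> i]]) (v t).
    apply/not_existsP => H; apply: (proj2_sig p i).
    have -> : repl (sval p) i = x i by rewrite /repl pi.
    apply: span_trans (xv i) => a [Na|[t _ <-]].
      by apply: span_gen; left.
    exact: contrapT (H t).
  pose q j := if pselect (j = i) then Some t else sval p j.
  have qE : repl q = fun j => if pselect (j = i) then v t else repl (sval p) j.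
    by apply: funext => j; rewrite /repl /q; case: pselect.
  have hq : indep N (repl q).
    rewrite qE; apply: indep_step Nt => j ji; have := proj2_sig p j; apply: contra_not.
    by apply: span_mono => a [?|[l [_ lj] <-]]; [left|right; exists l].
  have /(congr1 sval)/= qp : (exist (fun phi => indep N (repl phi)) q hq) = p.
    apply: maxp; apply/asboolP => j s /= pj; rewrite /q.
    by case: pselect => // ji; rewrite ji pi in pj.
  have := congr1 (@^~ i) qp; rewrite /q pi.
  by case: pselect.
pose f i := projT1 (cid (tot i)).
have fP i : sval p i = Some (f i) by rewrite /f; case: cid.
exists f => i j fij; apply: contrapT => ij; apply: (proj2_sig p i).
apply: span_gen; right; exists j => /=; first exact/nesym.
by rewrite /repl !fP fij.
Qed.

(** A maximal subset of P independent modulo N spans P modulo N. *)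
Lemma relative_basis N (P : set V) : exists Q : set V,
  [/\ Q `<=` P, indep N (fun q : {v | Q v} => sval q)
    & forall y, P y -> span (N `|` Q) y].
Proof.
pose ok (Q : set V) := Q `<=` P /\ forall x, Q x -> ~ span (N `|` [set y | Q y /\ y <> x]) x.
(* Unions of chains stay independent because a dependency is finite. *)
have [F Fok totF|Q [[QP indQ] maxQ]] := @Zorn_bigcup _ ok.
  split=> [x [Q /Fok[QP _] /QP]//|x [Q FQ Qx] Hspan].
  have fin y : span (N `|` [set y | (\bigcup_(X in F) X) y /\ y <> x]) y ->
      exists2 Q', F Q' & forall Q'', F Q'' -> Q' `<=` Q'' ->
      span (N `|` [set y | Q'' y /\ y <> x]) y.
    elim=> [|z [Nz|[[Q' FQ' Q'z] zx]]|c y1 y2 _ [Q1 F1 h1] _ [Q2 F2 h2]].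
    - by exists Q => // *; exact: span0.
    - by exists Q => // *; apply: span_gen; left.
    - by exists Q' => // Q'' _ Q'Q''; apply: span_gen; right; split=> //; exact: Q'Q''.
    - have [Q12|Q21] := totF _ _ F1 F2.
        exists Q2 => // Q' ? ?.
        by apply: span_lin; [apply: h1|apply: h2] => //; exact: subset_trans Q12 _.
      exists Q1 => // Q' ? ?.
      by apply: span_lin; [apply: h1|apply: h2] => //; exact: subset_trans Q21 _.
  have [Q' FQ' h] := fin _ Hspan.
  have [QQ'|Q'Q] := totF _ _ FQ FQ'.
    by have [_ /(_ x (QQ' _ Qx))] := Fok _ FQ'; apply; apply: h.
  by have [_ /(_ x Qx)] := Fok _ FQ; apply; apply: h.
exists Q; split=> // [[x Qx] /=|y Py].
  apply: contra_not (indQ x Qx); apply: span_mono => z [?|[[z' Qz'] /= zx <-]]; first by left.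
  by right; split=> // zz'; apply: zx; apply: eq_exist.
apply: contrapT => Ny; apply: (maxQ (y |` Q)).
  split=> [z Qz|/(_ y (or_introl erefl)) Qy]; first by right.
  by apply: Ny; apply: span_gen; right.
have yQ : ~ Q y by move=> Qy; apply: Ny; apply: span_gen; right.
split=> [z [->//|/QP//]|x].
have indy : indep N (fun j : {v | (y |` Q) v} => sval j).
  pose i : {v | (y |` Q) v} := exist _ y (or_introl erefl).
  have -> : (fun j : {v | (y |` Q) v} => sval j)
      = fun j => if pselect (j = i) then y else sval j.
    by apply: funext => j; case: pselect => [ji|] //=; rewrite ji.
  apply: indep_step => [[z Qz] /= zi|].
    have Qz' : Q z by case: (Qz) => // zy; case: zi; exact: eq_exist.
    apply: contra_not (indQ z Qz'); apply: span_mono => u [?|[[u' Qu] /= [ui uz] <-]].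
      by left.
    right; split; last by move=> E; apply: uz; exact: eq_exist.
    by case: Qu ui {uz} => [uy|//] ui; case: ui; exact: eq_exist.
  apply: contra_not Ny; apply: span_mono => u [?|[[u' Qu] /= ui <-]]; first by left.
  by right; case: (Qu) => // uy; case: ui; exact: eq_exist.
move=> yQx; apply: contra_not (indy (exist _ x yQx)); apply: span_mono => z [?|[Qz zx]].
  by left.
by right; exists (exist _ z Qz) => //= -[].
Qed.

Lemma basis_exists : exists B : set V, is_basis B.
Proof.
have [B [_ indB spanB]] := relative_basis set0 setT; exists B; split.
  move=> k b c injb bB sum0 i; apply: contrapT => /eqP ci.
  have [d dc] := fieldK ci.
  apply: (indB (exist _ (b i) (bB i))) => /=.
  have bi : b i = - d *: \sum_(j | j != i) c j *: b j.
    move: sum0; rewrite (bigD1 i) //= => /eqP; rewrite addr_eq0 => /eqP cb.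
    by rewrite scaleNr -scalerN -cb scalerA dc scale1r.
  rewrite {2}bi.
  apply: spanZ; elim/big_rec: _ => [|j y ji h]; first exact: span0.
  apply: span_lin h; apply: span_gen; right.
  exists (exist _ (b j) (bB j)) => //= -[/injb ij]; by rewrite ij eqxx in ji.
move=> v; have [|s [c [_ sB ->]]] := @span_uniq B v.
  by apply: span_mono (spanB v I) => z [].
exists (size s), (tnth (in_tuple s)), (fun i => c (tnth (in_tuple s) i)); split.
  by move=> i; apply: sB; exact: mem_tnth.
by rewrite big_tnth.
Qed.

Lemma is_basis_indep (B : set V) N : N `<=` [set 0] -> is_basis B ->
  indep N (fun b : {v | B v} => sval b).
Proof.
move=> N0 [LI _] [x Bx] /= Hx.
have {}Hx : span [set y | B y /\ y <> x] x.
  apply: span_trans Hx => a [/N0 -> |[[z Bz] /= zx <-]]; first exact: span0.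
  by apply: span_gen; split=> // E; apply: zx; exact: eq_exist.
have [s [c [us sB xE]]] := span_uniq Hx.
(* A combination of vectors of B other than x equal to x is a linear relation
   in which x has coefficient -1. *)
pose t := in_tuple (x :: s).
have ut : uniq t.
  by rewrite /= us andbT; apply/negP => /sB[].
pose d v := if v == x then -1 else c v.
have tB i : B (tnth t i).
  by have := mem_tnth i t; rewrite inE => /orP[/eqP ->//|/sB[]].
have sum0 : \sum_i d (tnth t i) *: tnth t i = 0.
  rewrite -(big_tnth _ _ (x :: s) xpredT (fun v => d v *: v)) big_cons /d eqxx.
  rewrite scaleN1r {1}xE addrC; apply/eqP; rewrite subr_eq0; apply/eqP.
  rewrite !big_seq; apply: eq_bigr => v vs; case: eqP => // vx.
  by have [_] := sB v vs.
have := LI _ _ _ (elimT (tuple_uniqP _) ut) tB sum0 ord0.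
by rewrite (tnth_nth 0) /d /= eqxx => /eqP; rewrite oppr_eq0 oner_eq0.
Qed.

End Span.

Lemma injective_cardinal_le (A B : Type) (f : A -> B) : injective f -> cardinal_le A B.
Proof.
move=> injf; apply/card_leP/injfunPex.
have h (T : Type) (x : T) : x \in [set: T] by rewrite inE.
exists (fun x : set_type [set: A] => exist _ (f (sval x)) (h _ _)) => //.
move=> [x xA] [y yA] _ _ /(congr1 sval) /= /injf xy.
exact: eq_exist.
Qed.

(** * Dimensions of subquotients *)
Section SubquotientDimension.
Variable K : comNzRingType.
Hypothesis fieldK : forall a : K, a != 0 -> exists b, b * a = 1.

Definition subspace (V : lmodType K) (N : set V) := forall y, span N y -> N y.

Lemma subspace0 (V : lmodType K) (N : set V) : subspace N -> N 0.
Proof. by apply; exact: span0. Qed.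

Lemma subspaceP (V : lmodType K) (N : set V) : N 0 ->
  (forall c x y, N x -> N y -> N (c *: x + y)) -> subspace N.
Proof. by move=> N0 NL y; elim=> // c x z _ Nx _; exact: NL. Qed.

Lemma dim_le_inj (V : lmodType K) (Z N : set V) S T (f : S -> T) :
  Z 0 -> injective f -> dim_le Z N S -> dim_le Z N T.
Proof.
move=> Z0 injf [v [Zv spv]].
pose w t := if pselect (exists s, f s = t) is left h then v (projT1 (cid h)) else 0.
have wf s : w (f s) = v s.
  rewrite /w; case: pselect => [h|[]]; last by exists s.
  by case: (cid h) => s' /= /injf ->.
exists w; split=> [t|y /spv]; first by rewrite /w; case: pselect.
by apply: span_mono => x [|[s _ <-]]; [left|right; exists (f s)].
Qed.

Lemma dim_le_mono (V : lmodType K) (Z N N' : set V) T :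
  N `<=` N' -> dim_le Z N T -> dim_le Z N' T.
Proof.
move=> NN' [v [Zv spv]]; exists v; split=> // y /spv.
by apply: span_mono => x [/NN'|]; [left|right].
Qed.

Lemma dim_le_quot (V1 V : lmodType K) (alpha : {linear V1 -> V})
    (Z1 N1 : set V1) (Z N : set V) T :
  subspace N ->
  (forall z, Z1 z -> Z (alpha z)) -> (forall z, N1 z -> N (alpha z)) ->
  (forall z, Z z -> exists z1, Z1 z1 /\ N (z - alpha z1)) ->
  dim_le Z1 N1 T -> dim_le Z N T.
Proof.
move=> sN aZ aN ex [v [Zv spv]]; exists (alpha \o v); split=> [t|z /ex[z1 [Zz1 Nz]]].
  exact/aZ.
rewrite -[z](subrK (alpha z1)); apply: spanD; first by apply: span_gen; left.
elim: (spv _ Zz1) => [|x [/aN Nx|[t _ <-]]|c x y _ hx _ hy].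
- by rewrite linear0; exact: span0.
- by apply: span_gen; left.
- by apply: span_gen; right; exists t.
- by rewrite linearP; exact: span_lin.
Qed.

(** A dimension count: an exact sequence Z1/N1 -> Z/N -> Z2/N2 bounds the dimension
of the middle term by the sum of the other two. A family spanning Z/N consists of
the images of the family spanning Z1/N1 and of lifts of a basis of the image in
Z2/N2; exchange bounds the size of that basis by T. *)
Lemma dim_le_exact (V1 V V2 : lmodType K)
    (alpha : {linear V1 -> V}) (beta : {linear V -> V2})
    (Z1 N1 : set V1) (Z N : set V) (Z2 N2 : set V2) S T :
  subspace Z -> subspace N -> subspace N2 ->
  (forall z, Z1 z -> Z (alpha z)) -> (forall z, N1 z -> N (alpha z)) ->
  (forall z, Z z -> Z2 (beta z)) ->
  (forall z, Z z -> N2 (beta z) -> exists z1, Z1 z1 /\ N (z - alpha z1)) ->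
  dim_le Z1 N1 S -> dim_le Z2 N2 T -> dim_le Z N (S + T).
Proof.
move=> sZ sN sN2 aZ aN bZ ex [v [Zv spv]] [w [Zw spw]].
(* A basis Q of the image of Z, indexed within T by phi, and its lifts u. *)
have [Q [QP indQ spQ]] := relative_basis fieldK N2 (beta @` Z).
have [q|phi phi_inj] := exchange fieldK indQ (v := w).
  by have [z Zz <-] := QP _ (proj2_sig q); apply/spw/bZ.
pose lft (q : {x | Q x}) := cid2 (QP _ (proj2_sig q)).
pose u (q : {x | Q x}) := s2val (lft q).
have Zu q : Z (u q) := s2valP (lft q).
have bu q : beta (u q) = sval q := s2valP' (lft q).
pose r (st : S + {x | Q x}) := match st with inl s => alpha (v s) | inr q => u q end.
pose g (st : S + {x | Q x}) : S + T := match st with inl s => inl s | inr q => inr (phi q) end.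
apply: (@dim_le_inj _ _ _ _ _ g); first exact: subspace0.
  by move=> [s|q] [s'|q'] //= [] => [->|/phi_inj ->].
exists r; split=> [[s|q]|z Zz] //=; first exact/aZ.
(* Subtracting a combination of the lifts moves z into the kernel of the map
   to Z2/N2. *)
have [z' [Zz' sz' N2z]] : exists z', [/\ Z z', span (range u) z' & N2 (beta (z - z'))].
  have [z' [Zz' sz' N2z]] : exists z', [/\ Z z', span (range u) z' & N2 (beta z - beta z')].
    have : span (N2 `|` Q) (beta z) by apply: spQ; exists z.
    elim: (beta z) / => [|x [Nx|Qx]|c x y _ [x' [Zx' sx' Nx]] _ [y' [Zy' sy' Ny]]].
    - by exists 0; rewrite linear0 subrr; split; [exact: subspace0|exact: span0|exact: subspace0].
    - by exists 0; rewrite linear0 subr0; split=> //; [exact: subspace0|exact: span0].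
    - exists (u (exist _ x Qx)); rewrite bu subrr; split=> //; last exact: subspace0.
      by apply: span_gen; exists (exist _ x Qx).
    exists (c *: x' + y'); split; [|exact: span_lin|].
      by apply: sZ; apply: span_lin; exact: span_gen.
    rewrite linearP opprD addrACA -scalerBr.
    by apply: sN2; apply: span_lin; exact: span_gen.
  by exists z'; rewrite linearB.
have [|z1 [Zz1 Nz1]] := ex (z - z') _ N2z.
  by apply: sZ; apply: spanB; exact: span_gen.
rewrite -[z](subrK z') -[z - z'](subrK (alpha z1)); apply: spanD; last first.
  apply: span_mono sz' => _ [q _ <-]; by right; exists (inr q).
apply: spanD; first by apply: span_gen; left.
elim: (spv _ Zz1) => [|x [/aN Nx|[s _ <-]]|c x y _ hx _ hy].
- by rewrite linear0; exact: span0.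
- by apply: span_gen; left.
- by apply: span_gen; right; exists (inl s).
- by rewrite linearP; exact: span_lin.
Qed.

(** The case of dim_le_exact in which the left term vanishes. *)
Lemma dim_le_sub (V V2 : lmodType K) (beta : {linear V -> V2})
    (Z N : set V) (Z2 N2 : set V2) T :
  subspace Z -> subspace N -> subspace N2 ->
  (forall z, Z z -> Z2 (beta z)) ->
  (forall z, Z z -> N2 (beta z) -> N z) ->
  dim_le Z2 N2 T -> dim_le Z N T.
Proof.
move=> sZ sN sN2 bZ bN dT.
have f_inj : injective (fun s : void + T =>
    match s with inl x => match x with end | inr t => t end).
  by move=> [[]|s] [[]|t] //= ->.
apply: (dim_le_inj _ f_inj); first exact: subspace0.
apply: (@dim_le_exact V V V2 idfun beta [set 0] N Z N Z2 N2) => //.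
- by move=> z ->; exact: subspace0.
- by move=> z Zz /(bN z Zz) Nz; exists 0; rewrite /= subr0.
- by exists (fun x : void => match x with end); split=> [[]|y ->]; exact: span0.
Qed.

Lemma dim_le_dimension (V : lmodType K) (N : set V) T :
  N `<=` [set 0] -> dim_le setT N T -> cardinal_le (dimension V) T.
Proof.
move=> N0 [v [_ spv]].
have Bb : is_basis (xget set0 (@is_basis K V)).
  by apply: xgetPex; exact: basis_exists.
have [b|f f_inj] := exchange fieldK (is_basis_indep N0 Bb) (v := v).
  exact: spv.
exact: injective_cardinal_le f_inj.
Qed.

Lemma dimension_dim_le (V : lmodType K) (N : set V) : dim_le setT N (dimension V).
Proof.
have [_ Bspan] : is_basis (xget set0 (@is_basis K V)).
  by apply: xgetPex; exact: basis_exists.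
exists (fun v => sval v); split=> // y _.
have [k [b [c [Bb ->]]]] := Bspan y.
elim/big_rec: _ => [|i x _ hx]; first exact: span0.
by apply: span_lin hx; apply: span_gen; right; exists (exist _ _ (Bb i)).
Qed.

End SubquotientDimension.

Section ToQuot.
Variables (R : nzRingType) (V : lmodType R) (N : submodClosed V).

Lemma to_quot_linear : linear (@to_quot R V N : V -> quotmod N).
Proof. by move=> a x y; rewrite to_quotD -quot_scaleE. Qed.

HB.instance Definition _ :=
  GRing.isLinear.Build R V (quotmod N) _ (@to_quot R V N) to_quot_linear.

Lemma to_quot_eq0 x : to_quot N x = 0 <-> x \in N.
Proof. by rewrite -[0](linear0 (to_quot N)) to_quot_eq subr0. Qed.

End ToQuot.

Section HomologyDimension.
Variable K : comNzRingType.
Hypothesis fieldK : forall a : K, a != 0 -> exists b, b * a = 1.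
Variables (U V W : lmodType K) (f : {linear U -> V}) (g : {linear V -> W}).

Definition cycles : set V := [set y | g y = 0].
Definition boundaries : set V := [set y | exists u, y = f u].

Lemma ker_predP y : y \in ker_pred g <-> g y = 0.
Proof. by split=> /eqP. Qed.

Lemma subspace_cycles : subspace cycles.
Proof.
apply: subspaceP; first exact: linear0.
by move=> c x y /= gx gy; rewrite /cycles /= linearP gx gy scaler0 addr0.
Qed.

Lemma subspace_boundaries : subspace boundaries.
Proof.
apply: subspaceP; first by exists 0; rewrite linear0.
by move=> c _ _ [x ->] [y ->]; exists (c *: x + y); rewrite linearP.
Qed.

Let bnd := [set z : submod (ker_pred g) | exists u, sval z = f u].

Lemma subspace_bnd : subspace bnd.
Proof.
apply: subspaceP; first by exists 0; rewrite linear0.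
by move=> c x y [u xu] [v yv]; exists (c *: u + v); rewrite linearP -xu -yv.
Qed.

Lemma subspace_set0 (X : lmodType K) : subspace [set (0 : X)].
Proof. by apply: subspaceP => // c x y -> ->; rewrite scaler0 addr0. Qed.

Lemma homology_dim_leP T :
  dim_le setT [set (0 : homology f g)] T <-> dim_le cycles boundaries T.
Proof.
have in_bnd z : z \in @bnd_pred K U V W f g <-> bnd z.
  by split=> [/asboolP|h]; [|apply/asboolP].
split=> [dT|dT].
  apply: (@dim_le_quot _ _ _ (val : {linear submod (ker_pred g) -> V}) setT bnd _ _ _
    subspace_boundaries) => //.
  - by move=> z _; exact/ker_predP/(valP z).
  - move=> y gy; have yk : y \in ker_pred g by apply/ker_predP.
    by exists (exist _ y yk); split=> //=; rewrite subrr; exists 0; rewrite linear0.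
  apply: (@dim_le_sub _ fieldK _ _ (to_quot (@bnd_pred K U V W f g))) dT => //.
  - exact: subspace_bnd.
  - exact: subspace_set0.
  - by move=> z _ /to_quot_eq0/in_bnd.
apply: (@dim_le_quot _ _ _ (to_quot (@bnd_pred K U V W f g)) setT bnd) => //.
- exact: subspace_set0.
- by move=> z /in_bnd/to_quot_eq0.
- by move=> z _; have [x ->] := to_quotP z; exists x; rewrite /= subrr.
apply: (@dim_le_sub _ fieldK _ _ (val : {linear submod (ker_pred g) -> V})) dT => //.
- exact: subspace_bnd.
- exact: subspace_boundaries.
- by move=> z _; exact/ker_predP/(valP z).
Qed.

End HomologyDimension.

(** * Extension of homomorphisms into the rationals modulo the integers *)
Lemma linear_ext (R : nzRingType) (U V : lmodType R) (f g : {linear U -> V}) :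
  f =1 g -> f = g.
Proof.
case: f g => [f [[fa] [fs]]] [g [[ga] [gs]]] /= /funext fg; subst g.
by rewrite (Prop_irrelevance fa ga) (Prop_irrelevance fs gs).
Qed.

Section SetSubmodule.
Variables (R : comNzRingType) (V : lmodType R) (N : set V).

(** The closure proof is an argument so that the submodule structure can be inferred
from the predicate. *)
Definition set_pred of subspace N : {pred V} := [pred x | `[< N x >]].

Lemma set_predP (sN : subspace N) x : x \in set_pred sN <-> N x.
Proof. by split=> /asboolP. Qed.

Lemma set_pred_closed (sN : subspace N) : submod_closed (set_pred sN).
Proof.
split=> [|a x y]; first by apply/(set_predP sN); exact: (subspace0 sN).
move=> /(set_predP sN) Nx /(set_predP sN) Ny; apply/(set_predP sN)/sN.
by apply: span_lin; exact: span_gen.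
Qed.

HB.instance Definition _ (sN : subspace N) :=
  GRing.isSubmodClosed.Build R V (set_pred sN) (set_pred_closed sN).

End SetSubmodule.

Section DivisibleGroup.

Lemma int_invn n : (n%:R : rat) != 0 -> (n%:R^-1 : rat) \is a Num.int -> n = 1%N.
Proof.
move=> n0 /Num.Theory.intrP[k kE].
have : (k * n%:Z)%:~R = 1 :> rat by rewrite intrM -kE -pmulrn mulVf.
move=> /(@intr_inj rat _ 1) /(congr1 absz).
by rewrite abszM !absz_nat => /eqP; rewrite muln_eq1 => /andP[_ /eqP].
Qed.

Definition int_pred : {pred zmodule rat} := [pred x : rat | x \is a Num.int].

Lemma int_pred_closed : submod_closed int_pred.
Proof.
split=> [|a x y]; rewrite !inE; first exact: rpred0.
move=> ix iy; have -> : a *: x + y = (x : rat) *~ a + (y : rat) by [].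
by rewrite rpredD // rpredMz.
Qed.

HB.instance Definition _ :=
  GRing.isSubmodClosed.Build int (zmodule rat) int_pred int_pred_closed.

Definition QmodZ : zmodType := quotmod int_pred.

Lemma QmodZ_div (d : QmodZ) n : (0 < n)%N -> exists e : QmodZ, d = e *+ n.
Proof.
move=> n0; have [x ->] := to_quotP d; exists (to_quot int_pred (x / n%:R)).
have xE : ((x : rat) / n%:R) *+ n = x.
  by rewrite -mulr_natr divfK // Num.Theory.pnatr_eq0 -lt0n.
by rewrite -raddfMn /= -[in LHS]xE.
Qed.

Lemma QmodZ_torsion n : (1 < n)%N -> exists2 d : QmodZ, d <> 0 & d *+ n = 0.
Proof.
move=> n1; have n0 : (n%:R : rat) != 0 by rewrite Num.Theory.pnatr_eq0 -lt0n ltnW.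
exists (to_quot int_pred (n%:R^-1 : rat)).
  by move=> /to_quot_eq0/(int_invn n0) n1'; rewrite n1' in n1.
have nE : (n%:R^-1 : rat) *+ n = 1 :> rat by rewrite -[LHS]mulr_natr mulVf.
rewrite -raddfMn; apply/to_quot_eq0.
by rewrite -[_ *+ n]/((n%:R^-1 : rat) *+ n) nE inE.
Qed.

End DivisibleGroup.

Section GroupExtension.
Variables (B : zmodType) (D : zmodType).
Hypothesis Ddiv : forall (d : D) n, (0 < n)%N -> exists e, d = e *+ n.

(** The graph of a homomorphism into D defined on a subgroup of B. *)
Definition partial_hom (G : set (B * D)) :=
  [/\ G (0, 0), forall x y, G x -> G y -> G (x - y) & forall d, G (0, d) -> d = 0].

Lemma partial_homN G x : partial_hom G -> G x -> G (- x).
Proof. by move=> [G0 GB _] Gx; rewrite -sub0r; exact: GB. Qed.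

Lemma partial_homD G x y : partial_hom G -> G x -> G y -> G (x + y).
Proof.
by move=> hG Gx Gy; rewrite -[y]opprK; case: (hG) => _ GB _; apply: GB => //; exact: partial_homN.
Qed.

Lemma partial_homMn G x n : partial_hom G -> G x -> G (x *+ n).
Proof.
move=> hG Gx; elim: n => [|n IHn]; first by rewrite mulr0n; case: hG.
by rewrite mulrS; exact: partial_homD.
Qed.

Lemma partial_hom_fun G b d d' : partial_hom G -> G (b, d) -> G (b, d') -> d = d'.
Proof.
move=> [_ GB G0] Gd Gd'; have := GB _ _ Gd Gd'.
by rewrite -[_ - _]/(b - b, d - d') subrr => /G0/eqP; rewrite subr_eq0 => /eqP.
Qed.

(** The multiples of b in the domain of G are those of n b for some n. A value at
b compatible with G is thus an n-th part of the value at n b; any value will do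
if only 0 is in the domain. *)
Lemma partial_hom_value G b : partial_hom G ->
  exists d, forall n e, G (b *+ n, e) -> e = d *+ n.
Proof.
move=> hG; case: (hG) => _ GB G0.
have [exn|none] := pselect (exists n, `[< exists e, (0 < n)%N /\ G (b *+ n, e) >]); last first.
  exists 0 => -[|n] e Ge; first by rewrite (G0 e).
  by case: none; exists n.+1; apply/asboolP; exists e.
case: (ex_minnP exn) => n /asboolP[e [n0 Ge]] minn.
have [d de] := Ddiv e n0; exists d => m e' Gm.
have GBq := partial_homMn (m %/ n) hG Ge.
have GX : forall k, ((b *+ n, e) *+ k : B * D) = (b *+ n *+ k, e *+ k).
  by elim=> // k IHk; rewrite !mulrS IHk.
rewrite GX in GBq; have Gr := GB _ _ Gm GBq.
have Er : (b *+ m, e') - (b *+ n *+ (m %/ n), e *+ (m %/ n))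
    = (b *+ (m %% n), e' - e *+ (m %/ n)) :> B * D.
  rewrite -[LHS]/(b *+ m - b *+ n *+ (m %/ n), e' - e *+ (m %/ n)).
  by rewrite {1}(divn_eq m n) mulrnDr -mulrnA mulnC addrAC subrr add0r.
rewrite Er in Gr; case: (posnP (m %% n)) => [r0|rpos].
  move: Gr; rewrite r0 mulr0n => /G0/eqP; rewrite subr_eq0 => /eqP ->.
  by rewrite de -mulrnA mulnC -[in RHS](@divnK n m) // /dvdn r0.
suff /minn : `[< exists e : D, (0 < m %% n)%N /\ G (b *+ (m %% n), e) >].
  by rewrite leqNgt ltn_mod n0.
by apply/asboolP; exists (e' - e *+ (m %/ n)).
Qed.

(** Divisible groups are injective: a maximal partial homomorphism is total, since
partial_hom_value allows a further extension to any element. *)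
Lemma extend_partial_hom G : partial_hom G -> exists f : B -> D,
  (forall x y, f (x - y) = f x - f y) /\ forall b d, G (b, d) -> f b = d.
Proof.
(* Adding G to the sets under consideration lets P hold for the union of the
   empty chain too. *)
move=> hG; pose P (X : set (B * D)) := partial_hom (X `|` G).
have [F FP totF|X [hX maxX]] := @Zorn_bigcup _ P.
  have pick x : ((\bigcup_(X in F) X) `|` G) x ->
      G x \/ exists2 X, F X & X x by case=> [[X FX Xx]|]; [right; exists X|left].
  have inF X x : F X -> (X `|` G) x -> ((\bigcup_(X in F) X) `|` G) x.
    by move=> FX [Xx|Gx]; [left; exists X|right].
  split; first by right; case: hG.
  - move=> x y /pick[Gx|[X FX Xx]] /pick[Gy|[Y FY Yy]].
    + by right; case: hG => _ GB _; exact: GB.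
    + by apply: (inF Y) => //; case: (FP _ FY) => _ GB _; apply: GB; [right|left].
    + by apply: (inF X) => //; case: (FP _ FX) => _ GB _; apply: GB; [left|right].
    + have [XY|YX] := totF _ _ FX FY.
        by apply: (inF Y) => //; case: (FP _ FY) => _ GB _; apply: GB; left => //; exact: XY.
      by apply: (inF X) => //; case: (FP _ FX) => _ GB _; apply: GB; left => //; exact: YX.
  - move=> d /pick[Gd|[X FX Xd]]; first by case: hG => _ _; apply.
    by case: (FP _ FX) => _ _; apply; left.
have tot b : exists d, (X `|` G) (b, d).
  apply: contrapT => nb; have [d dP] := partial_hom_value b hX.
  pose Y : set (B * D) := [set z | exists (k : int) x e,
    [/\ (X `|` G) (x, e) & z = (x + b *~ k, e + d *~ k)]].
  have XY : X `|` G `<=` Y.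
    by move=> [x e] Xx; exists 0, x, e; rewrite !mulr0z !addr0.
  have Yb : Y (b, d).
    by exists 1, 0, 0; rewrite !mulr1z !add0r; split=> //; case: hX.
  have dPz (k : int) e : (X `|` G) (b *~ k, e) -> e = d *~ k.
    case: k => n; first exact: dP.
    rewrite NegzE !mulrNz => /(partial_homN hX).
    rewrite -[- (_, _)]/(- - (b *~ n.+1), - e) opprK => /dP E.
    by apply: oppr_inj; rewrite opprK; exact: E.
  apply: (maxX Y).
    split=> [z Xz|/(_ _ Yb) Xb]; first by apply: XY; left.
    by apply: nb; exists d; left.
  have -> : P Y = partial_hom Y.
    congr partial_hom; apply/seteqP; split=> [z [//|Gz]|z Yz]; last by left.
    by apply: XY; right.
  split; first by apply: XY; case: hX.
    move=> _ _ [k [x [e [Xx ->]]]] [l [y [e' [Xy ->]]]].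
    exists (k - l), (x - y), (e - e'); split; first by case: hX => _ GB _; exact: GB Xx Xy.
    rewrite -[LHS]/(x + b *~ k - (y + b *~ l), e + d *~ k - (e' + d *~ l)).
    by rewrite !mulrzBr !opprD; congr (_, _); rewrite addrACA.
  move=> _ [k [x [e [Xx [E ->]]]]].
  have xE : x = b *~ (- k) by rewrite mulrNz; apply/eqP; rewrite -addr_eq0 -E.
  by rewrite xE in Xx; rewrite (dPz _ _ Xx) mulrNz addNr.
pose f b := projT1 (cid (tot b)).
have fP b : (X `|` G) (b, f b) by rewrite /f; case: cid.
exists f; split=> [x y|b d Gbd]; last first.
  by apply: (partial_hom_fun hX (fP b)); right.
apply: (partial_hom_fun hX (fP _)).
by case: hX => _ GB _; exact: GB (fP x) (fP y).
Qed.

End GroupExtension.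

(** * Embeddings into injective modules and injective resolutions *)
Lemma morphB_morphD (A D : zmodType) (f : A -> D) :
  {morph f : x y / x - y} -> {morph f : x y / x + y}.
Proof.
move=> fB x y; have f0 : f 0 = 0 by rewrite -[in LHS](subrr 0) fB subrr.
by rewrite -[y in LHS]opprK fB -[- y]sub0r fB f0 sub0r opprK.
Qed.

Section Coinduced.
Variables (R : comNzRingType) (I : Type).

(** The product of copies, indexed by I, of the coinduced module Hom_Z(R, Q/Z). *)
Definition coind_pred : {pred (I -> R -> QmodZ)} :=
  [pred h | `[< forall i x y, h i (x - y) = h i x - h i y >]].

Lemma coind_predP (h : I -> R -> QmodZ) :
  h \in coind_pred <-> forall i x y, h i (x - y) = h i x - h i y.
Proof. by split=> /asboolP. Qed.

Lemma coind_pred_closed : zmod_closed coind_pred.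
Proof.
split=> [|g h /coind_predP gP /coind_predP hP]; apply/coind_predP => i x y.
  by rewrite [RHS]subr0.
have E z : (g - h) i z = g i z - h i z by [].
by rewrite !E gP hP !opprD opprK addrACA.
Qed.

HB.instance Definition _ := GRing.isZmodClosed.Build _ coind_pred coind_pred_closed.

Definition coind : Type := {h : I -> R -> QmodZ | h \in coind_pred}.

HB.instance Definition _ := [isSub of coind for @sval _ (fun h => h \in coind_pred)].
HB.instance Definition _ := [Choice of coind by <:].
HB.instance Definition _ := [SubChoice_isSubZmodule of coind by <:].

Lemma coind_scale_subproof (a : R) (h : coind) :
  (fun i r => val h i (r * a)) \in coind_pred.
Proof.
by apply/coind_predP => i x y; rewrite mulrBl; exact: (iffLR (coind_predP _) (valP h)).
Qed.

Definition coind_scale a h : coind :=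
  Sub (fun i r => val h i (r * a)) (coind_scale_subproof a h).

Lemma coind_ext (g h : coind) : (forall i r, val g i r = val h i r) -> g = h.
Proof. by move=> gh; apply/val_inj/funext => i; exact/funext/gh. Qed.

Lemma coind_valD (g h : coind) i r : val (g + h) i r = val g i r + val h i r.
Proof. by []. Qed.

Lemma coind_scaleA a b h : coind_scale a (coind_scale b h) = coind_scale (a * b) h.
Proof. by apply: coind_ext => i r; rewrite !SubK mulrA. Qed.

Lemma coind_scale1 : left_id 1 coind_scale.
Proof. by move=> h; apply: coind_ext => i r; rewrite !SubK mulr1. Qed.

Lemma coind_scaleDr : right_distributive coind_scale +%R.
Proof. by move=> a g h; apply: coind_ext => i r; rewrite coind_valD !SubK. Qed.

Lemma coind_scaleDl h : {morph coind_scale^~ h : a b / a + b}.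
Proof.
move=> a b; apply: coind_ext => i r; rewrite coind_valD !SubK.
by rewrite mulrDr (morphB_morphD (iffLR (coind_predP _) (valP h) i)).
Qed.

HB.instance Definition _ := GRing.Zmodule_isLmodule.Build R coind
  coind_scaleA coind_scale1 coind_scaleDr coind_scaleDl.

Lemma coind_valZ a (h : coind) i r : val (a *: h) i r = val h i (r * a).
Proof. by []. Qed.

(** R-linear maps from A to Hom_Z(R, Q/Z) amount to additive maps from A to Q/Z, by
evaluation at 1. Those extend from A to B because Q/Z is divisible. *)
Lemma coind_injective : injective_module coind.
Proof.
move=> A B iota f iota_inj.
have ext i : exists g : B -> QmodZ, (forall x y, g (x - y) = g x - g y) /\
    forall a, g (iota a) = val (f a) i 1.
  pose G : set (B * QmodZ) := [set z | exists a, z = (iota a, val (f a) i 1)].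
  have hG : partial_hom G.
    split; first by exists 0; rewrite !linear0.
      by move=> _ _ [a ->] [b ->]; exists (a - b); rewrite !linearB.
    by move=> d [a [a0 ->]]; rewrite (_ : a = 0) ?linear0 //; apply: iota_inj; rewrite linear0.
  have [g [gB gG]] := extend_partial_hom QmodZ_div hG.
  by exists g; split=> // a; apply: gG; exists a.
pose g0 i := projT1 (cid (ext i)).
have g0B i : forall x y, g0 i (x - y) = g0 i x - g0 i y by rewrite /g0; case: cid => ? [].
have g0E i : forall a, g0 i (iota a) = val (f a) i 1 by rewrite /g0; case: cid => ? [].
have gP b : (fun i r => g0 i (r *: b)) \in coind_pred.
  by apply/coind_predP => i x y; rewrite scalerBl g0B.
pose g b : coind := Sub (fun i r => g0 i (r *: b)) (gP b).
have g_lin : linear g.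
  move=> a x y; apply: coind_ext => i r; rewrite coind_valD coind_valZ !SubK.
  by rewrite scalerDr scalerA (morphB_morphD (g0B i)).
pose gl : {linear B -> coind} := HB.pack g (GRing.isLinear.Build _ _ _ _ g g_lin).
exists gl => a; apply: coind_ext => i r; rewrite SubK -linearZ g0E linearZ /=.
by rewrite mul1r.
Qed.

End Coinduced.

Section CofreeModule.
Variables (R : comNzRingType) (M : lmodType R).

Definition char_group : Type := {chi : M -> QmodZ | forall x y, chi (x - y) = chi x - chi y}.

(** An injective module in which M embeds. Characters separate the points of
M, so evaluation at all of them embeds M. *)
Definition cofree : lmodType R := coind R char_group.

Lemma to_cofree_subproof (x : M) :
  (fun (chi : char_group) r => sval chi (r *: x)) \in @coind_pred R char_group.
Proof. by apply/coind_predP => chi a b; rewrite scalerBl (proj2_sig chi). Qed.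

Definition to_cofree_fun (x : M) : cofree :=
  Sub (fun chi r => sval chi (r *: x)) (to_cofree_subproof x).

Lemma to_cofree_linear : linear to_cofree_fun.
Proof.
move=> a x y; apply: coind_ext => chi r; rewrite coind_valD coind_valZ !SubK.
by rewrite scalerDr scalerA (morphB_morphD (proj2_sig chi)).
Qed.

HB.instance Definition _ := GRing.isLinear.Build R M cofree _ to_cofree_fun to_cofree_linear.

Definition to_cofree : {linear M -> cofree} := to_cofree_fun.

Lemma to_cofree_inj : injective to_cofree.
Proof.
suff ker0 x : to_cofree x = 0 -> x = 0.
  by move=> x y xy; apply/eqP; rewrite -subr_eq0; apply/eqP/ker0; rewrite linearB xy subrr.
move=> x0; apply: contrapT => xn0.
(* A character of the cyclic group generated by x which is nonzero at x sends x
   to some d killed by the order of x. *)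
have [d d0 dP] : exists2 d : QmodZ, d <> 0 & forall n, x *+ n = 0 -> d *+ n = 0.
  have [exn|none] := pselect (exists n, (0 < n)%N && (x *+ n == 0)).
    case: (ex_minnP exn) => n /andP[n0 /eqP xn] minn.
    have n1 : (1 < n)%N by case: n n0 xn {minn} => [//|[|//]] _ /xn0.
    have [d d0 dn] := QmodZ_torsion n1; exists d => // m xm.
    have : x *+ (m %% n) = 0.
      by move: xm; rewrite {1}(divn_eq m n) mulrnDr mulnC mulrnA xn mul0rn add0r.
    case: (posnP (m %% n)%N) => [r0 _|rpos xr].
      by rewrite (divn_eq m n) r0 addn0 mulnC mulrnA dn mul0rn.
    have := minn (m %% n)%N; rewrite rpos xr eqxx leqNgt ltn_mod n0 => /(_ isT); by [].
  have [d d0 _] := @QmodZ_torsion 2 isT; exists d => // -[|n] xn; first by rewrite mulr0n.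
  by case: none; exists n.+1; rewrite xn eqxx.
pose G : set (M * QmodZ) := [set z | exists k : int, z = (x *~ k, d *~ k)].
have hG : partial_hom G.
  split; first by exists 0; rewrite !mulr0z.
    by move=> _ _ [k ->] [l ->]; exists (k - l); rewrite !mulrzBr.
  move=> e [[n|n] [xn ->]]; first by apply: dP; rewrite xn.
  rewrite NegzE mulrNz -pmulrn dP ?oppr0 //; apply/eqP.
  by rewrite -oppr_eq0 pmulrn -mulrNz -NegzE -xn.
have [chi [chiB chiG]] := extend_partial_hom QmodZ_div hG.
apply: d0; rewrite -(chiG x d); last by exists 1; rewrite !mulr1z.
have := congr1 (fun h : cofree => val h (exist _ chi chiB) 1) x0.
by rewrite SubK /= scale1r.
Qed.

Lemma cofree_injective : injective_module cofree.
Proof. exact: coind_injective. Qed.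

End CofreeModule.

Section Cokernel.
Variables (R : comNzRingType) (U V : lmodType R) (f : {linear U -> V}).

Definition coker := quotmod (set_pred (@subspace_boundaries R U V f)).

Definition to_coker : {linear V -> coker} := to_quot (set_pred (@subspace_boundaries R U V f)).

Lemma to_coker_eq0 x : to_coker x = 0 <-> exists u, x = f u.
Proof. by rewrite to_quot_eq0 set_predP. Qed.

Lemma to_coker_surj z : exists x, z = to_coker x.
Proof. exact: to_quotP. Qed.

End Cokernel.

Section ResolutionExists.
Variables (R : comNzRingType) (M : lmodType R).

(** The cokernels met when M is resolved by cofree modules. *)
Fixpoint cosyzygy (n : nat) : lmodType R :=
  if n is k.+1 then coker (to_cofree (cosyzygy k)) else M.

Lemma injective_resolution_exists : inhabited (injective_resolution M).
Proof.
pose d n : {linear cofree (cosyzygy n) -> cofree (cosyzygy n.+1)} :=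
  to_cofree (cosyzygy n.+1) \o to_coker (to_cofree (cosyzygy n)).
have dP n x : d n x = 0 <-> exists y, x = to_cofree (cosyzygy n) y.
  rewrite -to_coker_eq0; split=> [|xE]; last by rewrite /d /= xE linear0.
  by rewrite -[0](linear0 (to_cofree (cosyzygy n.+1))) => /to_cofree_inj.
constructor; apply: (@InjectiveResolution R M (fun n => cofree (cosyzygy n)) d (to_cofree M)).
- by move=> n; exact: cofree_injective.
- exact: to_cofree_inj.
- exact: (dP 0%N).
- move=> n x; rewrite dP; split=> [[z ->]|[y ->]].
    by have [y ->] := to_coker_surj z; exists y.
  by exists (to_coker _ y).
Qed.

End ResolutionExists.

Section InjectiveExtension.
Variables (R : comNzRingType) (E : lmodType R).
Hypothesis injE : injective_module E.

(** Extension of a map given by its graph, which spares building its domain. *)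
Lemma inj_extend_graph (B : lmodType R) (G : set (B * E)) : subspace G ->
  (forall e, G (0, e) -> e = 0) ->
  exists g : {linear B -> E}, forall b e, G (b, e) -> g b = e.
Proof.
move=> sG G0; pose A := submod (set_pred sG).
pose i : {linear A -> B} := fst \o (val : {linear A -> (B * E)%type}).
pose f : {linear A -> E} := snd \o (val : {linear A -> (B * E)%type}).
have [|g gE] := @injE A B i f.
  suff ker0 x : i x = 0 -> x = 0.
    by move=> x y xy; apply/eqP; rewrite -subr_eq0; apply/eqP/ker0; rewrite linearB xy subrr.
  case: x => [[b e] xG]; rewrite /i /= => b0; apply: val_inj => /=.
  by move: (xG); rewrite b0 => /(set_predP sG)/G0 ->.
exists g => b e Gbe.
have xG : (b, e) \in set_pred sG by apply/set_predP.
by have := gE (exist _ (b, e) xG).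
Qed.

(** Maps into an injective module factor through the image of d. *)
Lemma inj_extend (A B : lmodType R) (d : {linear A -> B}) (f : {linear A -> E}) :
  (forall a, d a = 0 -> f a = 0) -> exists g : {linear B -> E}, forall a, g (d a) = f a.
Proof.
move=> df; have [||g gE] := @inj_extend_graph B [set z | exists a, z = (d a, f a)].
- apply: subspaceP; first by exists 0; rewrite !linear0.
  by move=> c _ _ [a ->] [b ->]; exists (c *: a + b); rewrite !linearP.
- by move=> e [a [/esym/df fa ->]].
by exists g => a; apply: gE; exists a.
Qed.

End InjectiveExtension.

(** * Independence of derived functors of the resolution *)
Definition short_exact (R : nzRingType) (A B C : lmodType R)
    (i : {linear A -> B}) (p : {linear B -> C}) :=
  [/\ injective i, forall c, exists b, c = p b
    & forall b, p b = 0 <-> exists a, b = i a].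

Lemma linear_inj (R : nzRingType) (A B : lmodType R) (f : {linear A -> B}) :
  (forall x, f x = 0 -> x = 0) -> injective f.
Proof.
move=> f0 x y xy; apply/eqP; rewrite -subr_eq0; apply/eqP/f0.
by rewrite linearB xy subrr.
Qed.

Lemma linear_inj0 (R : nzRingType) (A B : lmodType R) (f : {linear A -> B}) x :
  injective f -> f x = 0 -> x = 0.
Proof. by move=> f_inj fx; apply: f_inj; rewrite linear0. Qed.

Section Comparison.
Variables (R : comNzRingType) (K : comNzRingType).
Hypothesis fieldK : forall a : K, a != 0 -> exists b, b * a = 1.
Variable G : additive_functor R K.

Lemma fmapE_comp (U V W : lmodType R) (f : {linear U -> V}) (g : {linear V -> W})
    (h : {linear U -> W}) : (forall x, g (f x) = h x) ->
  forall x, fmap G g (fmap G f x) = fmap G h x.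
Proof.
move=> gfh x; rewrite -[LHS](@fmap_comp _ _ G _ _ _ g f x).
by congr (fmap G _ x); exact: linear_ext.
Qed.

Lemma fmapE_square (U V V' W : lmodType R) (f : {linear U -> V}) (g : {linear V -> W})
    (f' : {linear U -> V'}) (g' : {linear V' -> W}) : (forall x, g (f x) = g' (f' x)) ->
  forall x, fmap G g (fmap G f x) = fmap G g' (fmap G f' x).
Proof.
move=> E x; rewrite (@fmapE_comp _ _ _ f' g' (g' \o f')) //; exact: fmapE_comp.
Qed.

Lemma fmapE_add (U V : lmodType R) (f g h : {linear U -> V}) :
  (forall x, h x = f x + g x) -> forall x, fmap G h x = fmap G f x + fmap G g x.
Proof.
by move=> hfg x; rewrite -[RHS](@fmap_add _ _ G _ _ f g x); congr (fmap G _ x); exact: linear_ext.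
Qed.

Lemma fmapE_id (U : lmodType R) (f : {linear U -> U}) :
  (forall x, f x = x) -> forall x, fmap G f x = x.
Proof.
by move=> fE x; rewrite -[RHS](@fmap_id _ _ G _ x); congr (fmap G _ x); exact: linear_ext.
Qed.

Lemma fmapE_0 (U V : lmodType R) (f : {linear U -> V}) :
  (forall x, f x = 0) -> forall x, fmap G f x = 0.
Proof.
move=> f0 x; have := @fmapE_add _ _ f f f _ x; rewrite -[X in X = _]addr0.
by move=> /(_ _)/addrI <- // y; rewrite f0 addr0.
Qed.

Lemma fmapE_comp0 (U V W : lmodType R) (f : {linear U -> V}) (g : {linear V -> W}) :
  (forall x, g (f x) = 0) -> forall x, fmap G g (fmap G f x) = 0.
Proof. by move=> gf0 x; rewrite (@fmapE_comp _ _ _ f g (g \o f)) // fmapE_0. Qed.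

(** The bound by T for the cohomology in degree n of G applied to a complex. In degree 0
the boundaries are the image of a zero map, to agree with applied cohomology. *)
Definition coh_le (C : nat -> lmodType R) (d : forall n, {linear C n -> C n.+1})
    (n : nat) (T : Type) :=
  match n with
  | 0 => dim_le (cycles (fmap G (d 0%N)))
                (boundaries (\0 : {linear G (C 0%N) -> G (C 0%N)})) T
  | k.+1 => dim_le (cycles (fmap G (d k.+1))) (boundaries (fmap G (d k))) T
  end.

Lemma applied_cohomologyP (M : lmodType R) (E : injective_resolution M) n T :
  dim_le setT [set (0 : applied_cohomology G E n)] T <-> coh_le (res_d E) n T.
Proof. by case: n => [|n]; exact: homology_dim_leP. Qed.

Section Retract.
Variables (M M' : lmodType R) (f : {linear M -> M'}) (h : {linear M' -> M}).
Hypothesis hf : forall x, h (f x) = x.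
Variables (E : injective_resolution M) (E' : injective_resolution M').

(** What degree n-1 has to contribute in degree n: the part k of the homotopy that
factors through the previous differential, and the commutation of psi with it.
Only two consecutive degrees occur at a time, so that the chain maps are obtained
by induction instead of being constructed in all degrees at once. *)
Let prev_cond n : {linear res_obj E' n -> res_obj E n} ->
    {linear res_obj E n -> res_obj E n} -> Prop :=
  match n with
  | 0 => fun _ k => forall x, k x = 0
  | m.+1 => fun psi k =>
      exists (s0 : {linear res_obj E m.+1 -> res_obj E m})
             (psi0 : {linear res_obj E' m -> res_obj E m}),
        (forall x, k x = res_d E m (s0 x)) /\
        (forall x, psi (res_d E' m x) = res_d E m (psi0 x))
  end.

Let homotopy_at n := exists (phi : {linear res_obj E n -> res_obj E' n})
    (phi' : {linear res_obj E n.+1 -> res_obj E' n.+1})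
    (psi : {linear res_obj E' n -> res_obj E n})
    (psi' : {linear res_obj E' n.+1 -> res_obj E n.+1})
    (k : {linear res_obj E n -> res_obj E n})
    (s : {linear res_obj E n.+1 -> res_obj E n}),
  [/\ forall x, phi' (res_d E n x) = res_d E' n (phi x),
      forall x, psi' (res_d E' n x) = res_d E n (psi x),
      prev_cond psi k
    & forall x, psi (phi x) = (x + k x) + s (res_d E n x)].

Let homotopy_step n (phi : {linear res_obj E n -> res_obj E' n})
    (phi' : {linear res_obj E n.+1 -> res_obj E' n.+1})
    (psi : {linear res_obj E' n -> res_obj E n})
    (psi' : {linear res_obj E' n.+1 -> res_obj E n.+1})
    (s : {linear res_obj E n.+1 -> res_obj E n}) :
  (forall x, phi' (res_d E n x) = res_d E' n (phi x)) ->
  (forall x, psi' (res_d E' n x) = res_d E n (psi x)) ->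
  (forall x, res_d E n (psi (phi x)) = res_d E n (x + s (res_d E n x))) ->
  exists (phi'' : {linear res_obj E n.+2 -> res_obj E' n.+2})
    (psi'' : {linear res_obj E' n.+2 -> res_obj E n.+2})
    (s' : {linear res_obj E n.+2 -> res_obj E n.+1}),
  [/\ forall x, phi'' (res_d E n.+1 x) = res_d E' n.+1 (phi' x),
      forall x, psi'' (res_d E' n.+1 x) = res_d E n.+1 (psi' x)
    & forall x, psi' (phi' x) = (x + res_d E n (s x)) + s' (res_d E n.+1 x)].
Proof.
move=> phiP psiP sP.
have dd X (EX : injective_resolution X) m x : res_d EX m.+1 (res_d EX m x) = 0.
  by apply/res_exact; exists x.
have [|phi'' phi''P] := inj_extend (res_inj (i := E') (n := n.+2)) (d := res_d E n.+1)
    (f := res_d E' n.+1 \o phi').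
  by move=> x /res_exact[y ->] /=; rewrite phiP dd.
have [|psi'' psi''P] := inj_extend (res_inj (i := E) (n := n.+2)) (d := res_d E' n.+1)
    (f := res_d E n.+1 \o psi').
  by move=> x /res_exact[y ->] /=; rewrite psiP dd.
(* The failure of s to be a homotopy vanishes on the boundaries, so it factors
   through the next differential. *)
pose k : {linear res_obj E n.+1 -> res_obj E n.+1} :=
  (psi' \o phi') \- (idfun \+ (res_d E n \o s)).
have [|s' s'P] := inj_extend (res_inj (i := E) (n := n.+1)) (d := res_d E n.+1) (f := k).
  by move=> x /res_exact[y ->]; rewrite /k /= phiP psiP sP linearD subrr.
by exists phi'', psi'', s'; split=> // x; rewrite s'P /k /= addrC subrK.
Qed.

Let prev_cond_d n (psi : {linear res_obj E' n -> res_obj E n}) k :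
  prev_cond psi k -> forall x, res_d E n (k x) = 0.
Proof.
case: n k psi => [|n] k psi /= kP x; first by rewrite kP linear0.
by have [s0 [psi0 [-> _]]] := kP; apply/res_exact; exists (s0 x).
Qed.

Let homotopy_all n : homotopy_at n.
Proof.
elim: n => [|n [phi [phi' [psi [psi' [k [s [phiP psiP kP sP]]]]]]]].
  have aug0 X (EX : injective_resolution X) x : res_d EX 0 (res_aug EX x) = 0.
    by apply/res_exact0; exists x.
  have [|phi phiP] := inj_extend (res_inj (i := E') (n := 0%N)) (d := res_aug E)
      (f := res_aug E' \o f).
    by move=> x /(linear_inj0 (@res_aug_inj _ _ E)) ->; rewrite linear0.
  have [|psi psiP] := inj_extend (res_inj (i := E) (n := 0%N)) (d := res_aug E')
      (f := res_aug E \o h).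
    by move=> x /(linear_inj0 (@res_aug_inj _ _ E')) ->; rewrite linear0.
  have [|phi' phi'P] := inj_extend (res_inj (i := E') (n := 1%N)) (d := res_d E 0)
      (f := res_d E' 0 \o phi).
    by move=> x /res_exact0[y ->] /=; rewrite phiP /= aug0.
  have [|psi' psi'P] := inj_extend (res_inj (i := E) (n := 1%N)) (d := res_d E' 0)
      (f := res_d E 0 \o psi).
    by move=> x /res_exact0[y ->] /=; rewrite psiP /= aug0.
  have [|s sP] := inj_extend (res_inj (i := E) (n := 0%N)) (d := res_d E 0)
      (f := (psi \o phi) \- idfun).
    by move=> x /res_exact0[y ->] /=; rewrite phiP /= psiP /= hf subrr.
  exists phi, phi', psi, psi', \0, s; split=> // x.
  by rewrite addr0 sP /= addrC subrK.
have dk x : res_d E n (k x) = 0.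
  exact: prev_cond_d kP x.
have [|phi'' [psi'' [s' [phi''P psi''P s'P]]]] := homotopy_step (s := s) phiP psiP.
  by move=> x; rewrite sP !linearD dk addr0.
exists phi', phi'', psi', psi'', (res_d E n \o s), s'; split=> //.
by exists s, psi.
Qed.

(** A retraction h of f : M -> M' lifts to chain maps phi and psi between resolutions,
with psi phi homotopic to the identity. So the cohomology of G applied to E embeds
in that of G applied to E'. Taking f and h to be the identity shows that
resolutions of one module give equal dimensions. *)
Lemma coh_le_retract n T : coh_le (res_d E') n T -> coh_le (res_d E) n T.
Proof.
have [phi [phi' [psi [psi' [k [s [phiP psiP kP sP]]]]]]] := homotopy_all n.
have cyc z : cycles (fmap G (res_d E n)) z -> cycles (fmap G (res_d E' n)) (fmap G phi z).
  by move=> dz; rewrite /cycles /= -(fmapE_square phiP) dz linear0.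
have zE z : cycles (fmap G (res_d E n)) z ->
    z = fmap G psi (fmap G phi z) - fmap G k z.
  move=> dz; rewrite (@fmapE_comp _ _ _ phi psi (psi \o phi)) //.
  rewrite (@fmapE_add _ _ (idfun \+ k) (s \o res_d E n)) //.
  have -> : fmap G (s \o res_d E n) z = 0.
    rewrite -(@fmapE_comp _ _ _ (res_d E n) s (s \o res_d E n)) //.
    by rewrite (dz : fmap G (res_d E n) z = 0) linear0.
  rewrite addr0.
  by rewrite (@fmapE_add _ _ idfun k) // (@fmapE_id _ idfun) // addrK.
case: n phi phi' psi psi' k s phiP psiP kP sP cyc zE =>
    [|n] phi phi' psi psi' k s phiP psiP kP sP cyc zE;
  apply: (dim_le_sub fieldK (beta := fmap G phi)) => //.
- exact: subspace_cycles.
- exact: subspace_boundaries.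
- exact: subspace_boundaries.
- by move=> z dz [u uE]; exists 0; rewrite (zE z dz) uE /= linear0 (fmapE_0 kP) subrr.
- exact: subspace_cycles.
- exact: subspace_boundaries.
- exact: subspace_boundaries.
move=> z dz [u uE]; have [s0 [psi0 [kE psi0E]]] := kP.
exists (fmap G psi0 u - fmap G s0 z); rewrite {1}(zE z dz) uE (fmapE_square psi0E).
by rewrite linearB; congr (_ - _); symmetry; apply: fmapE_comp.
Qed.

End Retract.

(** A bound by T on the dimension of R^n G M. One resolution is enough to state it, since
ext_leP passes to any other. *)
Definition ext_le (n : nat) (M : lmodType R) T :=
  exists E : injective_resolution M, coh_le (res_d E) n T.

Lemma ext_leP (M : lmodType R) (E : injective_resolution M) n T :
  ext_le n M T <-> coh_le (res_d E) n T.
Proof.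
split=> [[E']|]; last by exists E.
exact: (@coh_le_retract _ _ idfun idfun).
Qed.

Lemma ext_le_retract (M M' : lmodType R) (f : {linear M -> M'}) (h : {linear M' -> M}) n T :
  (forall x, h (f x) = x) -> ext_le n M' T -> ext_le n M T.
Proof.
move=> hf [E' ET]; have [E] := injective_resolution_exists M.
by exists E; exact: coh_le_retract hf _ _ _ _ ET.
Qed.

End Comparison.

(** * Dimension shifting and long exact sequences *)
Lemma factor_surj (R : nzRingType) (A B C : lmodType R)
    (p : {linear A -> B}) (f : {linear A -> C}) :
  (forall b, exists a, b = p a) -> (forall a, p a = 0 -> f a = 0) ->
  exists h : {linear B -> C}, forall a, h (p a) = f a.
Proof.
move=> psurj pf; pose h b := f (projT1 (cid (psurj b))).
have hE a : h (p a) = f a.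
  rewrite /h; case: cid => a' /= pa; apply/eqP; rewrite -subr_eq0 -linearB.
  by apply/eqP/pf; rewrite linearB pa subrr.
have h_lin : linear h.
  move=> c x y; have [a ->] := psurj x; have [b ->] := psurj y.
  by rewrite -linearP !hE linearP.
by exists (HB.pack h (GRing.isLinear.Build _ _ _ _ h h_lin) : {linear B -> C}).
Qed.

Section PairMap.
Variables (R : nzRingType) (A E F : lmodType R).
Variables (f : {linear A -> E}) (g : {linear A -> F}).

Definition pair_map (a : A) : (E * F)%type := (f a, g a).

Lemma pair_map_linear : linear pair_map.
Proof. by move=> c x y; rewrite /pair_map !linearP. Qed.

HB.instance Definition _ :=
  GRing.isLinear.Build R A (E * F)%type _ pair_map pair_map_linear.

End PairMap.

Section Splice.
Variables (R : comNzRingType) (X E X' : lmodType R).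
Variables (i : {linear X -> E}) (p : {linear E -> X'}).
Hypotheses (injE : injective_module E) (ip : short_exact i p).
Variable E' : injective_resolution X'.

(** An injective resolution of X obtained by splicing 0 -> X -> E -> X' -> 0 with a
resolution of X'. *)
Definition splice_obj n : lmodType R := if n is k.+1 then res_obj E' k else E.

Definition splice_d n : {linear splice_obj n -> splice_obj n.+1} :=
  match n with 0 => res_aug E' \o p | k.+1 => res_d E' k end.

Lemma splice_inj n : injective_module (splice_obj n).
Proof. by case: n => [|n] //=; exact: res_inj. Qed.

Lemma splice_aug_inj : injective i. Proof. by case: ip. Qed.

Lemma splice_exact0 x : splice_d 0 x = 0 <-> exists y, x = i y.
Proof.
have [_ _ p_ker] := ip; rewrite -p_ker /=; split=> [|->]; last by rewrite linear0.
exact/linear_inj0/res_aug_inj.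
Qed.

Lemma splice_exact n x : splice_d n.+1 x = 0 <-> exists y, x = splice_d n y.
Proof.
case: n x => [|n] x; last exact: res_exact.
rewrite res_exact0; split=> [[y ->]|[y ->]]; last by exists (p y).
by have [_ p_surj _] := ip; have [e ->] := p_surj y; exists e.
Qed.

Definition splice : injective_resolution X :=
  InjectiveResolution splice_inj splice_aug_inj splice_exact0 splice_exact.

End Splice.

Section LongExact.
Variables (R : comNzRingType) (K : comNzRingType).
Hypothesis fieldK : forall a : K, a != 0 -> exists b, b * a = 1.
Variable G : additive_functor R K.

Definition left_exact := forall (A B C : lmodType R)
  (i : {linear A -> B}) (p : {linear B -> C}),
  injective i -> (forall b, p b = 0 <-> exists a, b = i a) ->
  injective (fmap G i) /\ forall y, fmap G p y = 0 -> exists x, y = fmap G i x.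

Hypothesis lexG : left_exact.

Lemma fmap_inj (A B : lmodType R) (f : {linear A -> B}) :
  injective f -> injective (fmap G f).
Proof. by move=> /lexG/(_ (to_coker_eq0 f))[]. Qed.

(** Left exactness identifies G X with the kernel of G applied to the first differential
of a resolution. *)
Lemma ext_le0 (X : lmodType R) T :
  ext_le G 0 X T <-> dim_le setT [set (0 : G X)] T.
Proof.
have [E] := injective_resolution_exists X.
rewrite (ext_leP fieldK G E) /=.
have [aug_inj aug_ker] := lexG (@res_aug_inj _ _ E) (@res_exact0 _ _ E).
have aug0 x : fmap G (res_d E 0) (fmap G (res_aug E) x) = 0.
  by apply: fmapE_comp0 => y; apply/res_exact0; exists y.
split=> dT.
  apply: (dim_le_sub fieldK (beta := fmap G (res_aug E))) dT => //.
  - exact: subspace_set0.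
  - exact: subspace_boundaries.
  - by move=> z _; exact: aug0.
  - by move=> z _ [u /= /(linear_inj0 aug_inj) ->].
apply: (dim_le_quot (alpha := fmap G (res_aug E))) dT => //.
- exact: subspace_boundaries.
- by move=> z _; exact: aug0.
- by move=> z ->; exists 0; rewrite !linear0.
- by move=> z /aug_ker[x ->]; exists x; split=> //; exists 0; rewrite subrr linear0.
Qed.

Section Shift.
Variables (X E X' : lmodType R) (i : {linear X -> E}) (p : {linear E -> X'}).
Hypotheses (injE : injective_module E) (ip : short_exact i p).

(** The first derived functor is the cokernel of G E -> G X', by left exactness
applied to the spliced resolution. *)
Lemma ext_le1 T :
  ext_le G 1 X T <-> dim_le setT (boundaries (fmap G p)) T.
Proof.
have [E'] := injective_resolution_exists X'.
rewrite (ext_leP fieldK G (splice injE ip E')) /=.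
have [aug_inj aug_ker] := lexG (@res_aug_inj _ _ E') (@res_exact0 _ _ E').
have aug0 x : fmap G (res_d E' 0) (fmap G (res_aug E') x) = 0.
  by apply: fmapE_comp0 => y; apply/res_exact0; exists y.
have compE u : fmap G (res_aug E' \o p) u = fmap G (res_aug E') (fmap G p u).
  by rewrite (@fmapE_comp _ _ _ _ _ _ p (res_aug E') (res_aug E' \o p)).
split=> dT.
  apply: (dim_le_sub fieldK (beta := fmap G (res_aug E'))) dT => //.
  - exact: subspace_boundaries.
  - exact: subspace_boundaries.
  - by move=> z _; exact: aug0.
  - by move=> z _ [u]; rewrite compE => /aug_inj ->; exists u.
apply: (dim_le_quot (alpha := fmap G (res_aug E'))) dT => //.
- exact: subspace_boundaries.
- by move=> z _; exact: aug0.
- by move=> z [u ->]; exists u; rewrite compE.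
- by move=> z /aug_ker[x ->]; exists x; split=> //; exists 0; rewrite subrr linear0.
Qed.

(** Dimension shifting: the spliced resolution of X is in positive degrees that of X'
moved by one. *)
Lemma ext_le_shift n T : ext_le G n.+2 X T <-> ext_le G n.+1 X' T.
Proof.
have [E'] := injective_resolution_exists X'.
by rewrite (ext_leP fieldK G (splice injE ip E')) (ext_leP fieldK G E').
Qed.

End Shift.

Lemma cofree_ses (X : lmodType R) : short_exact (to_cofree X) (to_coker (to_cofree X)).
Proof. by split; [exact: to_cofree_inj|exact: to_coker_surj|exact: to_coker_eq0]. Qed.

Lemma ext_le_inj n (X : lmodType R) S T (f : S -> T) :
  injective f -> ext_le G n X S -> ext_le G n X T.
Proof.
move=> f_inj [E ES]; exists E.
by case: n ES => [|n] /=; apply: dim_le_inj f_inj; exact: linear0.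
Qed.

Lemma injective_prod (E F : lmodType R) :
  injective_module E -> injective_module F -> injective_module (E * F)%type.
Proof.
move=> injE injF A B i f i_inj.
have [g gE] := injE A B i (fst \o f) i_inj.
have [h hE] := injF A B i (snd \o f) i_inj.
pose k b : E * F := (g b, h b).
have k_lin : linear k by move=> c x y; rewrite /k !linearP.
exists (HB.pack k (GRing.isLinear.Build _ _ _ _ k k_lin) : {linear B -> (E * F)%type}).
by move=> a; rewrite /= /k gE hE -surjective_pairing.
Qed.

Section Triple.
Variables (A B C : lmodType R) (i : {linear A -> B}) (p : {linear B -> C}).
Hypothesis ip : short_exact i p.

(** One step of the horseshoe lemma: B embeds in E = cofree A x cofree C compatibly
with A and C, and the cokernels form a short exact sequence. The maps ei and es
are the inclusions of the two factors. *)
Lemma horseshoe : exists (B' : lmodType R) (E : lmodType R) (j : {linear B -> E})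
    (q : {linear E -> B'}) (i' : {linear coker (to_cofree A) -> B'})
    (p' : {linear B' -> coker (to_cofree C)})
    (ei : {linear cofree A -> E}) (es : {linear cofree C -> E}),
  [/\ injective_module E, short_exact j q, short_exact i' p',
      forall e, i' (to_coker (to_cofree A) e) = q (ei e)
    & forall e, to_coker (to_cofree C) e = p' (q (es e))].
Proof.
have [i_inj p_surj p_ker] := ip.
have [|g gE] := inj_extend (@cofree_injective R A) (d := i) (f := to_cofree A).
  by move=> a /(linear_inj0 i_inj) ->; rewrite linear0.
pose E : lmodType R := (cofree A * cofree C)%type.
pose j : {linear B -> E} := pair_map g (to_cofree C \o p).
pose q := to_coker j.
pose ei : {linear cofree A -> E} := pair_map idfun \0.
pose es : {linear cofree C -> E} := pair_map \0 idfun.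
have pi0 a : p (i a) = 0 by apply/p_ker; exists a.
have jE b : j b = (g b, to_cofree C (p b)) by [].
have [||i' i'E] := @factor_surj _ _ _ _ (to_coker (to_cofree A)) (q \o ei).
- exact: to_coker_surj.
- move=> _ /to_coker_eq0[a ->]; apply/to_coker_eq0; exists (i a).
  by rewrite jE gE pi0 linear0.
have [||p' p'E] := @factor_surj _ _ _ _ q (to_coker (to_cofree C) \o snd).
- exact: to_coker_surj.
- move=> _ /to_coker_eq0[b ->]; apply/to_coker_eq0; by exists (p b).
exists (coker j), E, j, q, i', p', ei, es; split.
- exact: injective_prod (@cofree_injective R A) (@cofree_injective R C).
- split; [|exact: to_coker_surj|exact: to_coker_eq0].
  apply: linear_inj => b jb; have gb : g b = 0 := congr1 fst jb.
  have /(linear_inj0 (@to_cofree_inj R C))/p_ker[a ba] : to_cofree C (p b) = 0 := congr1 snd jb.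
  by move: gb; rewrite ba gE => /(linear_inj0 (@to_cofree_inj R A)) ->; rewrite linear0.
- split.
  + apply: linear_inj => x; have [e ->] := to_coker_surj x.
    rewrite i'E => /to_coker_eq0[b jb]; have eb : e = g b := congr1 fst jb.
    have /(linear_inj0 (@to_cofree_inj R C))/p_ker[a ba] : to_cofree C (p b) = 0.
      exact: esym (congr1 snd jb).
    by apply/to_coker_eq0; exists a; rewrite eb ba gE.
  + by move=> x; have [c ->] := to_coker_surj x; exists (q (es c)); rewrite p'E.
  + move=> x; have [[e c] ->] := to_coker_surj x; rewrite p'E; split=> [|[y]].
      move=> /to_coker_eq0[c0 cE]; have [b c0E] := p_surj c0.
      exists (to_coker _ (e - g b)); rewrite i'E; apply/eqP; rewrite -subr_eq0 -linearB.
      apply/eqP/to_coker_eq0; exists b; rewrite jE -c0E -(cE : c = to_cofree C c0).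
      by rewrite -[LHS]/(e - (e - g b), c - 0) opprB addrC subrK subr0.
    have [e' ->] := to_coker_surj y; rewrite i'E => /eqP; rewrite -subr_eq0 -linearB.
    move=> /eqP/to_coker_eq0[b] /(congr1 snd) cE; apply/to_coker_eq0.
    by exists (p b); rewrite -[RHS]cE -[RHS]/(c - 0) subr0.
- by move=> e; rewrite i'E.
- by move=> e; rewrite p'E.
Qed.

End Triple.

(** Exactness of R^n G A -> R^n G B -> R^n G C for n > 0, by dimension shifting
along the horseshoe down to n = 1. There a class of G B' that dies in G C' modulo
G (cofree C) is corrected by the section es and comes from G A'. *)
Lemma ext_le_middle n (A B C : lmodType R) (i : {linear A -> B}) (p : {linear B -> C}) S T :
  short_exact i p ->
  ext_le G n.+1 A S -> ext_le G n.+1 C T -> ext_le G n.+1 B (S + T).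
Proof.
elim: n A B C i p => [|n IHn] A B C i p ip;
  have [B' [E [j [q [i' [p' [ei [es [injE jq ip' i'E p'E]]]]]]]]] := horseshoe ip.
  rewrite (ext_le1 (@cofree_injective R A) (cofree_ses A)).
  rewrite (ext_le1 (@cofree_injective R C) (cofree_ses C)) (ext_le1 injE jq).
  have [i'_inj _ p'_ker] := ip'; have [_ Gp'_ker] := lexG i'_inj p'_ker.
  apply: (dim_le_exact fieldK (alpha := fmap G i') (beta := fmap G p')) => //.
  - exact: subspace_boundaries.
  - exact: subspace_boundaries.
  - by move=> _ [u ->]; exists (fmap G ei u); exact: fmapE_square.
  move=> z _ [u uE].
  have [|x xE] := Gp'_ker (z - fmap G q (fmap G es u)).
    rewrite linearB uE (@fmapE_comp _ _ _ _ _ _ es q (q \o es)) //.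
    by rewrite (@fmapE_comp _ _ _ _ _ _ (q \o es) p' (to_coker (to_cofree C))) ?subrr.
  exists x; split=> //; exists (fmap G es u); rewrite -xE.
  by rewrite opprB addrC subrK.
rewrite (ext_le_shift (@cofree_injective R A) (cofree_ses A)).
rewrite (ext_le_shift (@cofree_injective R C) (cofree_ses C)) (ext_le_shift injE jq).
exact: IHn ip'.
Qed.

Section Rotation.
Variables (A B C : lmodType R) (i : {linear A -> B}) (p : {linear B -> C}).
Hypothesis ip : short_exact i p.

(** Embedding A in an injective module through B turns A -> B -> C into the short
exact sequence C -> E/A -> E/B, which exhibits C as a first term. *)
Lemma coker_ses : exists (A' : lmodType R) (q : {linear cofree B -> A'})
    (delta : {linear C -> A'}) (r : {linear A' -> coker (to_cofree B)}),
  [/\ short_exact (to_cofree B \o i) q, short_exact delta r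
    & forall e, r (q e) = to_coker (to_cofree B) e].
Proof.
have [i_inj p_surj p_ker] := ip.
pose j : {linear A -> cofree B} := to_cofree B \o i.
have [||r rE] := @factor_surj _ _ _ _ (to_coker j) (to_coker (to_cofree B)).
- exact: to_coker_surj.
- by move=> _ /to_coker_eq0[a ->]; apply/to_coker_eq0; exists (i a).
have [||delta deltaE] := @factor_surj _ _ _ _ p (to_coker j \o to_cofree B) => //.
- by move=> b /p_ker[a ->]; apply/to_coker_eq0; exists a.
exists (coker j), (to_coker j), delta, r; split=> //.
  split; [|exact: to_coker_surj|exact: to_coker_eq0].
  by move=> x y /to_cofree_inj/i_inj.
split.
- apply: linear_inj => c; have [b ->] := p_surj c; rewrite deltaE.
  by move=> /to_coker_eq0[a /to_cofree_inj bE]; apply/p_ker; exists a.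
- by move=> x; have [e ->] := to_coker_surj x; exists (to_coker j e).
move=> x; have [e ->] := to_coker_surj x; rewrite rE; split=> [/to_coker_eq0[b ->]|[c]].
  by exists (p b); rewrite deltaE.
have [b ->] := p_surj c; rewrite deltaE => /eqP; rewrite -subr_eq0 -linearB.
move=> /eqP/to_coker_eq0[a aE]; apply/to_coker_eq0; exists (i a + b).
by rewrite linearD -[to_cofree B (i a)]aE subrK.
Qed.

(** Exactness of R^n G C -> R^(n+1) G A -> R^(n+1) G B: for n > 0 this is ext_le_middle
for C -> E/A -> E/B, and for n = 0 it follows from left exactness on that sequence. *)
Lemma ext_le_sub n S T :
  ext_le G n C S -> ext_le G n.+1 B T -> ext_le G n.+1 A (S + T).
Proof.
have [A' [q [delta [r [jq dr rE]]]]] := coker_ses.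
have injH := @cofree_injective R B.
case: n => [|n].
  rewrite ext_le0 (ext_le1 injH jq) (ext_le1 injH (cofree_ses B)).
  have [d_inj _ r_ker] := dr; have [_ Gr_ker] := lexG d_inj r_ker.
  apply: (dim_le_exact fieldK (alpha := fmap G delta) (beta := fmap G r)) => //.
  - exact: subspace_boundaries.
  - exact: subspace_boundaries.
  - by move=> _ ->; exists 0; rewrite !linear0.
  move=> z _ [u uE]; have [|x xE] := Gr_ker (z - fmap G q u).
    by rewrite linearB uE (@fmapE_comp _ _ _ _ _ _ q r (to_coker (to_cofree B))) ?subrr.
  by exists x; split=> //; exists u; rewrite -xE opprB addrC subrK.
rewrite (ext_le_shift injH jq) (ext_le_shift injH (cofree_ses B)).
exact: ext_le_middle dr.
Qed.

(** Pushing out along an embedding of A in an injective module E turns A -> B -> C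
into the short exact sequence B -> E x C -> E/A, whose middle term is C up to an
injective factor. *)
Lemma pushout_ses : exists (A' : lmodType R) (g : {linear B -> cofree A})
    (q : {linear cofree A -> A'}) (r : {linear (cofree A * C)%type -> A'}),
  [/\ short_exact (to_cofree A) q, short_exact (pair_map g p) r
    & forall e, r (e, 0) = q e].
Proof.
have [i_inj p_surj p_ker] := ip.
have [|g gE] := inj_extend (@cofree_injective R A) (d := i) (f := to_cofree A).
  by move=> a /(linear_inj0 i_inj) ->; rewrite linear0.
pose j : {linear B -> (cofree A * C)%type} := pair_map g p.
pose ei : {linear cofree A -> (cofree A * C)%type} := pair_map idfun \0.
exists (coker j), g, (to_coker j \o ei), (to_coker j); split=> //.
  split=> [|x|e]; first exact: to_cofree_inj.
    have [[e c] ->] := to_coker_surj x; have [b bE] := p_surj c.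
    exists (e - g b) => /=; apply/eqP; rewrite -subr_eq0 -linearB.
    apply/eqP/to_coker_eq0; exists b; rewrite -[RHS]/(g b, p b) -bE.
    by rewrite -[LHS]/(e - (e - g b), c - 0) opprB addrC subrK subr0.
  split=> [/to_coker_eq0[b]|[a ->]].
    by move=> [-> /esym/p_ker[a ->]]; exists a; rewrite gE.
  apply/to_coker_eq0; exists (i a); rewrite -[RHS]/(g (i a), p (i a)) gE.
  by congr (_, _); apply/esym/p_ker; exists a.
split; [|exact: to_coker_surj|exact: to_coker_eq0].
apply: linear_inj => b jb; have gb : g b = 0 := congr1 fst jb.
have /p_ker[a ba] : p b = 0 := congr1 snd jb.
by move: gb; rewrite ba gE => /(linear_inj0 (@to_cofree_inj R A)) ->; rewrite linear0.
Qed.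

(** Exactness of R^n G B -> R^n G C -> R^(n+1) G A for n > 0: ext_le_middle for
B -> E x C -> E/A bounds E x C, of which C is a retract. *)
Lemma ext_le_quot n S T :
  ext_le G n.+1 B S -> ext_le G n.+2 A T -> ext_le G n.+1 C (S + T).
Proof.
have [A' [g [q [r [jq dr rE]]]]] := pushout_ses.
rewrite (ext_le_shift (@cofree_injective R A) jq) => BS A'T.
have := ext_le_middle dr BS A'T.
by apply: (ext_le_retract fieldK (f := pair_map \0 idfun) (h := snd)).
Qed.

(** Exactness of G A -> G B -> G C -> R^1 G A, from left exactness on
B -> E x C -> E/A. An element z of G C dying in R^1 G A = G (E/A) / G E gives, with
its lift u to G E, an element of G (E x C) in the kernel of the map to G (E/A). *)
Lemma ext_le_quot0 S T :
  dim_le setT (boundaries (fmap G i)) S -> ext_le G 1 A T -> ext_le G 0 C (S + T).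
Proof.
have [A' [g [q [r [jq dr rE]]]]] := pushout_ses.
rewrite (ext_le1 (@cofree_injective R A) jq) ext_le0 => BS A'T.
pose es : {linear C -> (cofree A * C)%type} := pair_map \0 idfun.
pose ei : {linear cofree A -> (cofree A * C)%type} := pair_map idfun \0.
have [d_inj _ r_ker] := dr; have [_ Gr_ker] := lexG d_inj r_ker.
apply: (dim_le_exact fieldK (alpha := fmap G p) (beta := fmap G (r \o es))) BS A'T => //.
- exact: subspace_set0.
- exact: subspace_boundaries.
- move=> _ [u ->] /=; apply: fmapE_comp0 => a; have [_ _ p_ker] := ip.
  by apply/p_ker; exists a.
move=> z _ [u uE]; have [|x xE] := Gr_ker (fmap G es z - fmap G ei u).
  rewrite linearB (@fmapE_comp _ _ _ _ _ _ es r (r \o es)) // uE.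
  by rewrite (@fmapE_comp _ _ _ _ _ _ ei r q) ?subrr.
exists x; split=> //=; apply/eqP; rewrite subr_eq0; apply/eqP.
have := congr1 (fmap G (snd : {linear (cofree A * C)%type -> C})) xE.
rewrite linearB (@fmapE_comp _ _ _ _ _ _ es snd idfun) // (@fmapE_id _ _ _ _ idfun) //.
rewrite (@fmapE_comp0 _ _ _ _ _ _ ei snd) // subr0 => ->.
by apply: fmapE_comp.
Qed.

End Rotation.
End LongExact.

(** * Cohomology of a complex of injective modules *)
Section CardinalSum.
Variable F : int -> Type.

(** Injectivity is checked in the sum over all integers, where an index is not paired
with a proof that it lies in the range. *)
Lemma cardinal_sum_inj (a b : int) X (g : X -> {i : int & F i}) : injective g ->
  (forall x, a <= projT1 (g x) <= b) ->
  exists f : X -> cardinal_sum a b F, injective f.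
Proof.
move=> g_inj gab.
pose f x : cardinal_sum a b F :=
  existT (fun i : {i : int | a <= i <= b} => F (val i))
    (exist _ (projT1 (g x)) (gab x)) (projT2 (g x)).
pose forget (z : cardinal_sum a b F) := existT F (val (projT1 z)) (projT2 z).
exists f; apply: (inj_compr (f := forget)) => x y /=.
by rewrite /forget /= !surjective_existT => /g_inj.
Qed.

Lemma cardinal_sum1 (a b c : int) : a <= c <= b ->
  exists f : F c -> cardinal_sum a b F, injective f.
Proof.
move=> abc; apply: (@cardinal_sum_inj _ _ _ (existT F c)) => // x y.
exact: existT_inj2.
Qed.

Lemma cardinal_sum_add (a b a' b' c : int) :
  a' <= a -> b <= b' -> a' <= c <= b' -> ~~ (a <= c <= b) ->
  exists f : cardinal_sum a b F + F c -> cardinal_sum a' b' F, injective f.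
Proof.
move=> a'a bb' c_in c_out.
pose g (x : cardinal_sum a b F + F c) : {i : int & F i} :=
  match x with inl z => existT F (val (projT1 z)) (projT2 z) | inr y => existT F c y end.
apply: (@cardinal_sum_inj _ _ _ g) => [|[[[i hi] x]|x] //=]; last first.
  by move: hi {x}; lia.
move=> [[[i hi] x]|x] [[[j hj] y]|y] /= E.
- have ij := existT_inj1 E; rewrite /= in ij; subst j.
  by rewrite (bool_irrelevance hj hi) (existT_inj2 E).
- by have ij := existT_inj1 E; rewrite /= in ij; subst i; rewrite hi in c_out.
- by have ij := existT_inj1 E; rewrite /= in ij; subst j; rewrite hj in c_out.
by rewrite (existT_inj2 E).
Qed.

End CardinalSum.

Section MainInequality.
Variables (R K : comNzRingType).
Hypothesis fieldK : forall a : K, a != 0 -> exists b, b * a = 1.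
Variable G : additive_functor R K.
Hypothesis lexG : left_exact G.

Lemma zero_module_injective (X : lmodType R) :
  (forall x : X, x = 0) -> injective_module X.
Proof. by move=> X0 A B i f _; exists \0 => a; rewrite [RHS]X0. Qed.

Lemma ext_le_zero (X : lmodType R) n : (forall x : X, x = 0) -> ext_le G n X void.
Proof.
move=> X0; have inj0 : forall m : nat, injective_module X.
  by move=> m; exact: zero_module_injective.
have ex (x : X) : (\0 : {linear X -> X}) x = 0 <-> exists y, x = y.
  by split=> _ //; exists x.
have exd (x : X) : (\0 : {linear X -> X}) x = 0 <-> exists y, x = (\0 : {linear X -> X}) y.
  by split=> _ //; exists x; rewrite (X0 x).
exists (@InjectiveResolution R X (fun=> X) (fun=> \0) idfun inj0 (@inj_id X) ex (fun=> exd)).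
have GX0 (y : G X) : y = 0.
  transitivity (fmap G (idfun : {linear X -> X}) y); first by rewrite fmapE_id.
  by apply: fmapE_0 => x; exact: X0.
by case: n => [|n]; exists (fun x : void => match x with end); split=> [[]|y _];
   rewrite (GX0 y); exact: span0.
Qed.

Section Complex.
Variables (C : nat -> lmodType R) (d : forall n, {linear C n -> C n.+1}).
Hypothesis dd0 : forall n x, d n.+1 (d n x) = 0.
Hypothesis injC : forall n, injective_module (C n).

(** The zero map into degree 0 stands for the missing differential, as in the
definition of applied cohomology; then the boundaries in degree 0 vanish. *)
Definition prev_obj n : lmodType R := if n is k.+1 then C k else C 0.
Definition prev_d n : {linear prev_obj n -> C n} :=
  match n with 0 => \0 | k.+1 => d k end.

(** Cycles, boundaries and cohomology of the complex, as modules, form the short exact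
sequences B^n -> Z^n -> H^n and Z^n -> C^n -> B^(n+1). *)
Definition Zmod n : lmodType R := submod (@ker_pred R (C n) (C n.+1) (d n)).
Definition Bmod n : lmodType R :=
  submod (@bnd_pred R (prev_obj n) (C n) (C n.+1) (prev_d n) (d n)).
Definition Hmod n : lmodType R := homology (prev_d n) (d n).

Definition Z_incl n : {linear Zmod n -> C n} := val.
Definition B_incl n : {linear Bmod n -> Zmod n} := val.
Definition H_proj n : {linear Zmod n -> Hmod n} :=
  to_quot (@bnd_pred R (prev_obj n) (C n) (C n.+1) (prev_d n) (d n)).

Lemma BZH_ses n : short_exact (B_incl n) (H_proj n).
Proof.
split=> [||z]; [exact: val_inj|exact: to_quotP|].
rewrite to_quot_eq0; split=> [zB|[b ->]]; last exact: (valP b).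
by exists (exist _ z zB).
Qed.

Definition BC_incl n : {linear Bmod n -> C n} := Z_incl n \o B_incl n.

Lemma BC_incl_inj n : injective (BC_incl n).
Proof. by move=> x y /val_inj/val_inj. Qed.

Lemma Z_inclP n x : d n x = 0 <-> exists z, x = Z_incl n z.
Proof.
split=> [dx|[z ->]]; last exact/ker_predP/(valP z).
have xZ : x \in ker_pred (d n) by apply/ker_predP.
by exists (exist _ x xZ).
Qed.

Lemma d_bnd n (x : C n) : exists b : Bmod n.+1, BC_incl n.+1 b = d n x.
Proof.
have xZ : d n x \in ker_pred (d n.+1) by apply/ker_predP.
have xB : exist _ (d n x) xZ \in @bnd_pred R _ _ _ (prev_d n.+1) (d n.+1).
  by apply/asboolP; exists x.
by exists (exist _ (exist _ (d n x) xZ) xB).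
Qed.

Lemma d_corestr_exists n : exists h : {linear C n -> Bmod n.+1},
  forall x, BC_incl n.+1 (h x) = d n x.
Proof.
pose h x := projT1 (cid (@d_bnd n x)).
have hE x : BC_incl n.+1 (h x) = d n x by rewrite /h; case: cid.
have h_lin : linear h.
  by move=> c x y; apply: (@BC_incl_inj n.+1); rewrite linearP !hE linearP.
by exists (HB.pack h (GRing.isLinear.Build _ _ _ _ h h_lin) : {linear C n -> Bmod n.+1}).
Qed.

Definition d_corestr n := projT1 (cid (d_corestr_exists n)).

Lemma d_corestrE n x : BC_incl n.+1 (d_corestr n x) = d n x.
Proof. by rewrite /d_corestr; case: cid. Qed.

Lemma ZCB_ses n : short_exact (Z_incl n) (d_corestr n).
Proof.
split=> [|b|x]; first exact: val_inj.
  have /asboolP[u uE] := valP b; exists u; apply: (@BC_incl_inj n.+1).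
  by rewrite d_corestrE.
rewrite -Z_inclP -d_corestrE; split=> [->|]; first by rewrite linear0.
exact: linear_inj0 (@BC_incl_inj n.+1).
Qed.

Lemma fmap_dE n u :
  fmap G (d n) u = fmap G (BC_incl n.+1) (fmap G (d_corestr n) u).
Proof. by symmetry; apply: fmapE_comp => x; rewrite -d_corestrE. Qed.

Lemma fmap_dE2 n u : fmap G (d n) u
  = fmap G (Z_incl n.+1) (fmap G (B_incl n.+1) (fmap G (d_corestr n) u)).
Proof.
rewrite (@fmapE_comp _ _ _ _ _ _ (B_incl _) (Z_incl _) (BC_incl _)) //.
exact: fmap_dE.
Qed.

Lemma Bmod0 (b : Bmod 0) : b = 0.
Proof. by have /asboolP[u uE] := valP b; do 2!apply: val_inj. Qed.

(** As C^n is injective, R^(p+1) G Z^n = R^p G B^(n+1) for p > 0. *)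
Lemma ext_shift_ZB n p T : ext_le G p.+2 (Zmod n) T <-> ext_le G p.+1 (Bmod n.+1) T.
Proof. exact: (ext_le_shift fieldK G (@injC n) (ZCB_ses n)). Qed.

(** Going down: h^p Z^n <= h^p B^n + h^p H^n and h^p B^n = h^(p+1) Z^(n-1), where h^p is
the dimension of R^p G. The total degree q = p + n is the same all along, so F i
need only bound h^(q-i) H^i. *)
Lemma ext_le_Z F q n p : (forall i r, (r + i = q)%N -> ext_le G r (Hmod i) (F i%:Z)) ->
  (p.+1 + n = q)%N -> ext_le G p.+1 (Zmod n) (cardinal_sum 0 n F).
Proof.
move=> hF; elim: n p => [|n IHn] p pq.
  have [//|f f_inj] := @cardinal_sum1 F 0 0 0.
  have g_inj : injective (fun x : void + F 0 =>
      match x with inl v => match v with end | inr y => y end).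
    by move=> [[]|x] [[]|y] /= ->.
  apply/(ext_le_inj f_inj)/(ext_le_inj g_inj)/(ext_le_middle fieldK lexG (BZH_ses 0)).
    exact/ext_le_zero/Bmod0.
  exact: hF.
have [||||f f_inj] := @cardinal_sum_add F 0 n 0 n.+1 n.+1; [lia..|].
apply/(ext_le_inj f_inj)/(ext_le_middle fieldK lexG (BZH_ses n.+1)); last exact: hF.
by apply/ext_shift_ZB/IHn; lia.
Qed.

Lemma ext_le_B F q n p : (forall i r, (r + i = q)%N -> ext_le G r (Hmod i) (F i%:Z)) ->
  (p.+1 + n = q)%N -> ext_le G p.+1 (Bmod n) (cardinal_sum 0 (n%:Z - 1) F).
Proof.
move=> hF; case: n => [|n] pq.
  by apply: (@ext_le_inj _ _ _ _ _ void _ (fun v => match v with end));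
     [case|exact/ext_le_zero/Bmod0].
apply/ext_shift_ZB; have -> : n.+1%:Z - 1 = n by lia.
by apply: ext_le_Z hF _; lia.
Qed.

(** A class of G applied to the complex in degree n+1 is represented in G Z^(n+1). Its
image in G H^(n+1) is counted by F (n+1), and the kernel is the image of
G B^(n+1) / G C^n = R^1 G Z^n, which ext_le_Z bounds. *)
Lemma coh_le_total F q : (forall i r, (r + i = q)%N -> ext_le G r (Hmod i) (F i%:Z)) ->
  coh_le G d q (cardinal_sum 0 q F).
Proof.
move=> hF; have H0 : dim_le setT [set (0 : G (Hmod q))] (F q).
  by apply/(ext_le0 fieldK lexG)/hF.
have [zi_inj _ zi_ker] := ZCB_ses q; have [Gzi_inj _] := lexG zi_inj zi_ker.
have Gzi_ker y : fmap G (d q) y = 0 -> exists x, y = fmap G (Z_incl q) x.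
  by have [_] := lexG zi_inj (@Z_inclP q); apply.
have d_zi x : fmap G (d q) (fmap G (Z_incl q) x) = 0.
  by apply: fmapE_comp0 => z; exact/ker_predP/(valP z).
have [bi_inj _ bi_ker] := BZH_ses q; have [_ Gbi_ker] := lexG bi_inj bi_ker.
case: q => [|n] in F hF H0 zi_inj zi_ker Gzi_inj Gzi_ker d_zi bi_inj bi_ker Gbi_ker *.
  have [//|f f_inj] := @cardinal_sum1 F 0 0 0.
  apply: (dim_le_inj _ f_inj); first exact: linear0.
  apply: (dim_le_quot (alpha := fmap G (Z_incl 0)) (Z1 := setT) (N1 := [set 0])) => //.
  - exact: subspace_boundaries.
  - by move=> z _; exact: d_zi.
  - by move=> _ ->; exists 0; rewrite !linear0.
  - by move=> z /Gzi_ker[x ->]; exists x; split=> //; exists 0; rewrite subrr linear0.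
  apply: (dim_le_sub fieldK (beta := fmap G (H_proj 0))) H0 => //.
  - exact: subspace_set0.
  - exact: subspace_set0.
  - move=> z _ /Gbi_ker[b ->]; rewrite (@fmapE_0 _ _ G _ _ (B_incl 0)) // => x.
    by rewrite (Bmod0 x) linear0.
have [||||f f_inj] := @cardinal_sum_add F 0 n 0 n.+1 n.+1; [lia..|].
apply: (dim_le_inj _ f_inj); first exact: linear0.
have Z1 : dim_le setT (boundaries (fmap G (d_corestr n))) (cardinal_sum 0 n F).
  by apply/(ext_le1 fieldK lexG (@injC n) (ZCB_ses n))/(ext_le_Z hF); lia.
apply: (dim_le_quot (alpha := fmap G (Z_incl n.+1)) (Z1 := setT)
    (N1 := boundaries (fmap G (B_incl n.+1) \o fmap G (d_corestr n)))) => //.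
- exact: subspace_boundaries.
- by move=> z _; exact: d_zi.
- by move=> _ [u ->]; exists u; rewrite fmap_dE2.
- by move=> z /Gzi_ker[x ->]; exists x; split=> //; exists 0; rewrite subrr linear0.
apply: (dim_le_exact fieldK (alpha := fmap G (B_incl n.+1)) (beta := fmap G (H_proj n.+1)))
  Z1 H0 => //.
- exact: subspace_boundaries.
- exact: subspace_set0.
- by move=> _ [u ->]; exists u.
- by move=> z _ /Gbi_ker[b ->]; exists b; split=> //; exists 0; rewrite subrr linear0.
Qed.

(** Going up: h^(p+1) Z^t = h^p B^(t+1) <= h^(p-1) H^(t+1) + h^p Z^(t+1). This ends at
R^1 G Z^(q-1) = G B^q / G C^(q-1), which embeds in the cohomology in degree q. *)
Lemma ext_le_Z_coh F q T s t : coh_le G d q T ->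
  (forall i r, (r + i + 1 = q)%N -> ext_le G r (Hmod i) (F i%:Z)) ->
  (s.+1 + t = q)%N -> ext_le G s.+1 (Zmod t) (T + cardinal_sum (t%:Z + 1) (q%:Z - 1) F).
Proof.
move=> cohT hF; elim: s t => [|s IHs] t stq.
  apply: (@ext_le_inj _ _ _ _ _ T _ inl) => [x y []//|]; move: cohT; rewrite -stq /= => cohT.
  apply/(ext_le1 fieldK lexG (@injC t) (ZCB_ses t)).
  apply: (dim_le_sub fieldK (beta := fmap G (BC_incl t.+1))) cohT => //.
  - exact: subspace_boundaries.
  - exact: subspace_boundaries.
  - by move=> z _; apply: fmapE_comp0 => b; exact/ker_predP/(valP (val b)).
  - by move=> z _ [u]; rewrite fmap_dE => /(fmap_inj lexG (@BC_incl_inj t.+1)) ->; exists u.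
apply/ext_shift_ZB.
have [||||f f_inj] := @cardinal_sum_add F (t.+1%:Z + 1) (q%:Z - 1) (t%:Z + 1) (q%:Z - 1) (t.+1);
  [lia..|].
pose g (x : F t.+1 + (T + cardinal_sum (t.+1%:Z + 1) (q%:Z - 1) F)) :
    T + cardinal_sum (t%:Z + 1) (q%:Z - 1) F :=
  match x with inl y => inr (f (inr y)) | inr (inl y) => inl y | inr (inr y) => inr (f (inl y)) end.
apply: (@ext_le_inj _ _ _ _ _ _ _ g).
  by move=> [x|[x|x]] [y|[y|y]] //= [] => [/f_inj[->]|/f_inj|->|/f_inj|/f_inj[->]].
apply: (ext_le_sub fieldK lexG (BZH_ses t.+1)); first by apply: hF; lia.
by apply: IHs; lia.
Qed.

(** From B^t -> Z^t -> H^t one has h^s H^t <= h^s Z^t + h^(s+1) B^t. The first term is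
bounded by going up and the second one by going down. For s = 0 the image of G Z^t
in G H^t is a quotient of the cohomology in degree t. *)
Lemma ext_le_H F1 F2 s t T : coh_le G d (s + t) T ->
  (forall i r, (r + i = s + t + 1)%N -> ext_le G r (Hmod i) (F1 i%:Z)) ->
  (forall i r, (r + i + 1 = s + t)%N -> ext_le G r (Hmod i) (F2 i%:Z)) ->
  ext_le G s (Hmod t) (cardinal_sum 0 (t%:Z - 1) F1 + T
    + cardinal_sum (t%:Z + 1) (s%:Z + t%:Z - 1) F2).
Proof.
move=> cohT hF1 hF2.
have hB : ext_le G s.+1 (Bmod t) (cardinal_sum 0 (t%:Z - 1) F1).
  by apply: ext_le_B hF1 _; lia.
case: s => [|s] in hF1 hF2 cohT hB *; last first.
  have hZ := ext_le_Z_coh cohT hF2 erefl.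
  have := ext_le_quot fieldK lexG (BZH_ses t) hZ hB.
  apply: (@ext_le_inj _ _ _ _ _ _ _ (fun x => match x with
    inl (inl y) => inl (inr y) | inl (inr y) => inr y | inr y => inl (inl y) end)).
  by move=> [[x|x]|x] [[y|y]|y] //= [->].
apply: (@ext_le_inj _ _ _ _ _ (T + cardinal_sum 0 (t%:Z - 1) F1) _ (fun x => match x with
    inl y => inl (inr y) | inr y => inl (inl y) end)).
  by move=> [x|x] [y|y] //= [->].
apply: (ext_le_quot0 fieldK lexG (BZH_ses t)) hB.
case: t cohT {hF1 hF2} => [|t] cohT /=.
  apply: (@dim_le_mono _ _ _ [set 0]); first by move=> _ ->; exists 0; rewrite linear0.
  apply: (dim_le_sub fieldK (beta := fmap G (Z_incl 0))) cohT => //.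
  - exact: subspace_set0.
  - exact: subspace_boundaries.
  - by move=> z _; apply: fmapE_comp0 => x; exact/ker_predP/(valP x).
  - move=> z _ [u /= z0]; apply: (linear_inj0 (fmap_inj lexG _) z0); exact: val_inj.
apply: (@dim_le_mono _ _ _ (boundaries (fmap G (B_incl t.+1) \o fmap G (d_corestr t)))).
  by move=> _ [u ->]; exists (fmap G (d_corestr t) u).
apply: (dim_le_sub fieldK (beta := fmap G (Z_incl t.+1))) cohT => //.
- exact: subspace_boundaries.
- exact: subspace_boundaries.
- by move=> z _; apply: fmapE_comp0 => x; exact/ker_predP/(valP x).
move=> z _ [u]; rewrite fmap_dE2 => /(fmap_inj lexG) zE; exists u; apply: zE; exact: val_inj.
Qed.

End Complex.
End MainInequality.

(** * Torsion submodules of injective modules *)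
Section Ideals.
Variable R : comNzRingType.

Definition is_ideal (A : set R) := @subspace R R^o A.

Lemma is_idealMl A a x : is_ideal A -> A x -> A (a * x).
Proof. by move=> iA Ax; apply: (iA); apply: spanZ; exact: span_gen. Qed.

Lemma is_idealD A x y : is_ideal A -> A x -> A y -> A (x + y).
Proof. by move=> iA Ax Ay; apply: (iA); apply: spanD; exact: span_gen. Qed.

Lemma idealr_of_set (A : set R) : is_ideal A -> ~ A 1 ->
  exists P : idealr R, forall x, x \in P <-> A x.
Proof.
move=> iA A1; pose S : R -> bool := fun x => `[< A x >].
have S_closed : idealr_closed S.
  split; first exact/asboolP/(subspace0 iA).
    by apply/negP => /asboolP.
  move=> a x y /asboolP Ax /asboolP Ay; apply/asboolP.
  by apply: is_idealD => //; exact: is_idealMl.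
pose P : idealr R := HB.pack S (isIdealr.Build R S S_closed).
by exists P => x; split=> [/asboolP|?]; last exact/asboolP.
Qed.

Lemma prime_idealr_of_set (A : set R) : is_ideal A -> ~ A 1 ->
  (forall a b, A (a * b) -> A a \/ A b) ->
  exists P : prime_idealr R, forall x, x \in P <-> A x.
Proof.
move=> iA A1 Aprime; have [Q QA] := idealr_of_set iA A1.
have Q_prime : prime_idealr_closed Q.
  by move=> a b /QA/Aprime[] /QA ->; rewrite ?orbT.
pose P : prime_idealr R := HB.pack (Q : R -> bool) Q (isPrimeIdealrClosed.Build R Q Q_prime).
by exists P.
Qed.

Lemma finitely_generated_of_set (A : set R) : noetherian R -> is_ideal A ->
  exists s : seq R, (forall x, x \in s -> A x) /\
    forall B, is_ideal B -> (forall x, x \in s -> B x) -> A `<=` B.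
Proof.
move=> noeth iA; have [n [g gP]] := noeth (set_pred iA).
exists (codom g); split.
  move=> x /codomP[i ->]; apply/(set_predP iA)/gP.
  exists (fun j => if j == i then 1 else 0).
  rewrite (bigD1 i) //= eqxx mul1r big1 ?addr0 // => j /negPf ->.
  by rewrite mul0r.
move=> B iB gB x /(set_predP iA)/gP[c ->].
elim/big_rec: _ => [|i y _ By]; first exact: subspace0 iB.
by apply: is_idealD => //; apply: is_idealMl => //; apply/gB/codom_f.
Qed.

(** A nonempty chain of ideals contains its union, because that is finitely generated. *)
Lemma noetherian_max (P : set (set R)) : noetherian R ->
  (forall A, P A -> is_ideal A) -> (exists A, P A) ->
  exists A, P A /\ forall B, P B -> A `<=` B -> B `<=` A.
Proof.
move=> noeth Pideal [A0 PA0].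
(* The empty set is admitted as the union of the empty chain. *)
have [F FP totF|A [PA maxA]] := @Zorn_bigcup _ (fun A => P A \/ A = set0).
  have [[B [FB PB]]|noP] := pselect (exists B, F B /\ P B); last first.
    right; apply/seteqP; split=> // x [B FB Bx].
    by case: (FP B FB) => [PB|B0]; [case: noP; exists B|rewrite B0 in Bx].
  left; set U := \bigcup_(X in F) X.
  have join X Y : F X -> P X -> F Y -> P Y -> exists Z, [/\ F Z, P Z, X `<=` Z & Y `<=` Z].
    move=> FX PX FY PY; have [XY|YX] := totF _ _ FX FY.
      by exists Y; split=> // x.
    by exists X; split=> // x.
  have inU x : U x -> exists X, [/\ F X, P X & X x].
    by move=> [X FX Xx]; case: (FP X FX) => [PX|X0]; [exists X|rewrite X0 in Xx].
  have iU : is_ideal U.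
    apply: subspaceP; first by exists B => //; exact: subspace0 (Pideal B PB).
    move=> c x y /inU[X [FX PX Xx]] /inU[Y [FY PY Yy]].
    have [Z [FZ PZ XZ YZ]] := join X Y FX PX FY PY; exists Z => //.
    have iZ := Pideal Z PZ; apply: is_idealD => //; last exact: YZ.
    by apply: is_idealMl => //; exact: XZ.
  have [s [sU sgen]] := finitely_generated_of_set noeth iU.
  have [Z [FZ PZ sZ]] : exists Z, [/\ F Z, P Z & forall x, x \in s -> Z x].
    elim: s sU {sgen} => [|x s IHs] sU; first by exists B.
    have [|Y [FY PY sY]] := IHs; first by move=> y ys; apply: sU; rewrite inE ys orbT.
    have [X [FX PX Xx]] := inU x (sU x (mem_head _ _)).
    have [Z [FZ PZ XZ YZ]] := join X Y FX PX FY PY; exists Z; split=> // y.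
    by rewrite inE => /orP[/eqP ->|/sY]; [exact: XZ|exact: YZ].
  suff -> : U = Z by [].
  by apply/seteqP; split; [apply: sgen => //; exact: Pideal|exact: bigcup_sup].
case: PA => [PA|A_0]; last first.
  case: (maxA A0); last by left.
  rewrite A_0; split=> // /(_ 0); apply; exact: subspace0 (Pideal _ PA0).
exists A; split=> // B PB AB; apply: contrapT => BA.
by apply: (maxA B); [split|left].
Qed.

End Ideals.

Section GammaInjective.
Variables (R : comNzRingType) (I J : ideal R).

(** The support of R x consists of the primes that contain the annihilator of x. *)
Lemma GammaP (M : lmodType R) (x : M) : x \in @Gamma_pred R I J M <->
  forall p : prime_idealr R, (forall a, a *: x = 0 -> a \in p) -> W I J p.
Proof.
split=> [/asboolP Wx p px|Wx].
  apply: Wx; apply: contrapT => /Supp_cyclic[u ux].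
  by have := valP u; rewrite (px _ ux).
apply/asboolP => p px; apply: Wx => a ax; apply: contrapT => /negP pa.
by apply: (iffRL (Supp_cyclic x p)) px; exists (Sub a pa).
Qed.

Lemma W_mono (p q : prime_idealr R) : {subset p <= q} -> W I J p -> W I J q.
Proof.
move=> pq [n n0 Wp]; exists n => // x /Wp[a [b [aJ bp ->]]].
by exists a, b; split=> //; exact: pq.
Qed.

Hypothesis noeth : noetherian R.
Variable E : lmodType R.
Hypothesis injE : injective_module E.

Let N : set E := [set x | x \in @Gamma_pred R I J E].

Let subspaceN : subspace N.
Proof.
apply: subspaceP; first exact: rpred0.
by move=> c x y Nx Ny; rewrite /N /=; apply: rpredD => //; exact: rpredZ.
Qed.

(** A submodule K of E maximal among those meeting the torsion N trivially, so that N
is essential modulo K. *)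
Let complement : exists K : set E, [/\ subspace K, forall x, K x -> N x -> x = 0
  & forall y, ~ K y -> exists (n : E) (k : E) (r : R), [/\ N n, n != 0, K k & n = k + r *: y]].
Proof.
pose P (K : set E) := subspace (K `|` [set 0]) /\ forall x, K x -> N x -> x = 0.
have subsp0 (K : set E) : K 0 -> K `|` [set 0] = K.
  by move=> K0; apply/seteqP; split=> [x [//|->//]|x]; left.
have [F FP totF|K [[sK KN] maxK]] := @Zorn_bigcup _ P.
  split; last by move=> x [K FK Kx]; case: (FP K FK) => _; apply.
  apply: subspaceP; first by right.
  have closed K c x y : F K -> (K `|` [set 0]) x -> (K `|` [set 0]) y ->
      ((\bigcup_(X in F) X) `|` [set 0]) (c *: x + y).
    move=> FK Kx Ky; case: (FP K FK) => sK _.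
    have [|->] : (K `|` [set 0]) (c *: x + y).
    - by apply: sK; apply: span_lin; exact: span_gen.
    - by left; exists K.
    - by right.
  move=> c x y [[X FX Xx]|->] [[Y FY Yy]|->].
  - have [XY|YX] := totF _ _ FX FY.
      by apply: (closed Y) => //; left => //; exact: XY.
    by apply: (closed X) => //; left => //; exact: YX.
  - by apply: (closed X) => //; [left|right].
  - by apply: (closed Y) => //; [right|left].
  - by right; rewrite scaler0 addr0.
have K0 : K 0.
  apply: contrapT => K0; apply: (maxK (K `|` [set 0])).
    split=> [x Kx|/(_ 0) K0']; first by left.
    by apply: K0; apply: K0'; right.
  by split; [rewrite subsp0 //; right|move=> x [/KN//|->]].
rewrite subsp0 // in sK; exists K; split=> // y Ky.
pose K' := [set z | exists (k : E) (r : R), K k /\ z = k + r *: y].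
have K'0 : K' 0 by exists 0, 0; rewrite scale0r addr0.
apply: contrapT => none; apply: (maxK K').
  split=> [x Kx|/(_ y) K'y]; first by exists x, 0; rewrite scale0r addr0.
  by apply/Ky/K'y; exists 0, 1; rewrite scale1r add0r.
split.
  rewrite subsp0 //; apply: subspaceP => // c _ _ [k [r [Kk ->]]] [l [t [Kl ->]]].
  exists (c *: k + l), (c * r + t); split.
    by apply: sK; apply: span_lin; exact: span_gen.
  by rewrite scalerDr scalerDl scalerA addrACA.
move=> _ [k [r [Kk ->]]] Nx; apply: contrapT => /eqP x0; apply: none.
by exists (k + r *: y), k, r.
Qed.

(** The torsion N of an injective module E is a retract of E. The projection of N + K
to N along K extends to rho : E -> E, and the point is that its values are
torsion. Let p be a prime containing the annihilator of rho x; as rho kills K, it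
contains the annihilator of x modulo K. A maximal one among the annihilators modulo
K of the multiples of x that lie in p is a prime q. As N is essential modulo K, q
contains the annihilator of some n in N, so q belongs to W I J, and so does p. *)
Lemma Gamma_retraction : exists rho : {linear E -> E},
  (forall x, N (rho x)) /\ forall x, N x -> rho x = x.
Proof.
have [K [sK KN Kmax]] := complement.
have [||rho rhoE] := @inj_extend_graph R E injE E
  [set z | exists n k, [/\ N n, K k & z = (n + k, n)]].
- apply: subspaceP; first by exists 0, 0; rewrite addr0; split=> //; exact: subspace0.
  move=> c _ _ [n [k [Nn Kk ->]]] [n' [k' [Nn' Kk' ->]]].
  exists (c *: n + n'), (c *: k + k'); split.
  + by apply: subspaceN; apply: span_lin; exact: span_gen.
  + by apply: sK; apply: span_lin; exact: span_gen.
  + by rewrite -[LHS]/(c *: (n + k) + (n' + k'), c *: n + n') scalerDr addrACA.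
- move=> e [n [k [Nn Kk [/esym/eqP nk ->]]]]; apply: KN => //.
  have -> : n = (-1) *: k by rewrite scaleN1r; apply/eqP; rewrite -addr_eq0.
  by apply: sK; apply: spanZ; exact: span_gen.
have rhoN n : N n -> rho n = n.
  by move=> Nn; apply: rhoE; exists n, 0; rewrite addr0; split=> //; exact: subspace0.
have rhoK k : K k -> rho k = 0.
  by move=> Kk; apply: rhoE; exists 0, k; rewrite add0r; split=> //; exact: subspace0.
exists rho; split=> // x; apply/GammaP => p px.
pose ann y : set R := [set a | K (a *: y)].
have swap (a b : R) (y : E) : a *: (b *: y) = b *: (a *: y).
  by rewrite !scalerA mulrC.
have ideal_ann y : is_ideal (ann y).
  apply: subspaceP; first by rewrite /ann /= scale0r; exact: subspace0.
  move=> c a b Ka Kb; rewrite /ann /= scalerDl -scalerA.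
  by apply: sK; apply: span_lin; exact: span_gen.
pose P := [set A | exists r : R, A = ann (r *: x) /\ forall a, A a -> a \in p].
have [A [[r [AE Ap]] maxA]] : exists A, P A /\ forall B, P B -> A `<=` B -> B `<=` A.
  apply: noetherian_max => //; first by move=> _ [r [-> _]].
  exists (ann (1 *: x)), 1; split=> // a; rewrite scale1r => Kax.
  by apply: px; rewrite -linearZ rhoK.
have A1 : ~ A 1 by move=> /Ap; rewrite idealr1.
have iA : is_ideal A by rewrite AE.
(* With y = r x and A = ann y: if a is not in A, then ann (b y) is strictly
   larger than A, so by maximality some s outside p kills b y modulo K. The
   annihilator of s y is contained in p, hence equal to A, and contains b. *)
have Aprime a b : A (a * b) -> A a \/ A b.
  move=> Aab; have [Aa|Aa] := pselect (A a); first by left.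
  right; set B := ann (b *: (r *: x)).
  have AB : A `<=` B.
    move=> c; rewrite AE /B /ann /= (swap c b) => Kc.
    by apply: sK; apply: spanZ; exact: span_gen.
  have Ba : B a by move: Aab; rewrite AE /B /ann /= -scalerA.
  have [s [Bs ps]] : exists s, B s /\ s \notin p.
    apply: contrapT => none; apply/Aa/(maxA B) => //.
    exists (b * r); rewrite -scalerA; split=> // s Bs; apply/negPn/negP => ps.
    by apply: none; exists s.
  have Ks : ann (s *: (r *: x)) b.
    by rewrite /ann /= (swap b s); exact: Bs.
  apply: (maxA _ _ _ _ Ks).
    exists (s * r); rewrite -scalerA; split=> // t Kt.
    have : A (t * s) by rewrite AE /ann /= -scalerA.
    by move=> /Ap; rewrite prime_idealrM (negPf ps) orbF.
  move=> c; rewrite AE /ann /= => Kc; rewrite (swap c s).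
  by apply: sK; apply: spanZ; exact: span_gen.
have [q qA] := prime_idealr_of_set iA A1 Aprime.
have Ky : ~ K (r *: x) by move=> Ky; apply: A1; rewrite AE /ann /= scale1r.
have [n [k [t [Nn n0 Kk nE]]]] := Kmax _ Ky.
apply: (@W_mono q); first by move=> a /qA/Ap.
apply: (iffLR (GammaP n) Nn) => a an.
have Aat : A (a * t).
  rewrite AE /ann /= -scalerA (_ : t *: (r *: x) = n - k); last by rewrite nE addrAC subrr add0r.
  rewrite scalerBr an sub0r -scaleNr.
  by apply: sK; apply: spanZ; exact: span_gen.
apply/qA; case: (Aprime _ _ Aat) => // At; case/eqP: n0; apply: KN => //.
rewrite nE; move: At; rewrite AE => At.
by apply: sK; apply: spanD; exact: span_gen.
Qed.

(** A retract of an injective module is injective. *)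
Lemma Gamma_injective : injective_module (Gamma I J E).
Proof.
have [rho [rhoN rhoid]] := Gamma_retraction.
move=> A B i f i_inj; pose v : {linear Gamma I J E -> E} := val.
have [g gE] := @injE A B i (v \o f) i_inj.
pose h b : Gamma I J E := Sub (rho (g b)) (rhoN (g b)).
have h_lin : linear h by move=> c x y; apply: val_inj; rewrite /= !linearP.
exists (HB.pack h (GRing.isLinear.Build _ _ _ _ h h_lin) : {linear B -> Gamma I J E}) => a.
by apply: val_inj; rewrite /= gE rhoid //; exact: (valP (f a)).
Qed.

End GammaInjective.

(** * Localization at the maximal ideal of a local ring *)
Section LocalizationFunctor.
Variables (R : comNzRingType) (p : prime_idealr R).

Section LocMap.
Variables (U V : lmodType R) (f : {linear U -> V}).

Definition loc_map (z : locmod p U) : locmod p V := frac (f (num z)) (den z).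

Lemma loc_mapE x s : loc_map (frac x s) = frac (f x) s.
Proof.
have [u e] := num_frac x s; apply/frac_eq; exists u.
by rewrite -!linearZ e.
Qed.

Lemma loc_map_linear : linear loc_map.
Proof.
move=> c y z; have [a [r ->]] := loc_fracP c; have [x [s ->]] := fracP y.
have [w [t ->]] := fracP z.
have scE (X : lmodType R) (v : X) q :
  loc_frac a r *: (frac v q : locmod p X) = frac (a *: v) (denomM r q) by exact: loc_scaleE.
rewrite scE fracD !loc_mapE scE fracD. 
by rewrite linearD [f (_ *: (_ *: _))]linearZ [f (a *: x)]linearZ [f (_ *: w)]linearZ.
Qed.

HB.instance Definition _ :=
  GRing.isLinear.Build (loc p) (locmod p U) (locmod p V) _ loc_map loc_map_linear.

End LocMap.

(** The functor Hom(k(p), X_p) of X, whose derived functors give the Bass numbers,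
as localization is exact and, for local rings, preserves injective modules. *)
Definition residue_functor : additive_functor R (residue (@loc_max R p)).
Proof.
refine (@AdditiveFunctor R (residue (@loc_max R p))
  (fun X => hom_residue (@loc_max R p) (locmod p X))
  (fun U V f => @hom_map _ (@loc_max R p) _ _ (loc_map f)) _ _ _).
- move=> U h; apply: hom_eq => x; rewrite SubK /=.
  by have [y [s ->]] := fracP (val h x); rewrite loc_mapE.
- move=> U V W' g f h; apply: hom_eq => x; rewrite !SubK /=.
  by have [y [s ->]] := fracP (val h x); rewrite !loc_mapE.
- move=> U V f g h; apply: hom_eq => x; rewrite hom_valD !SubK /=.
  have [y [s ->]] := fracP (val h x); rewrite !loc_mapE fracD; apply/frac_eq.
  exists (denom1 p); rewrite !SubK -scalerDr !scalerA; congr (_ *: _); ring.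
Defined.

Lemma to_residue_eq0 (S : comNzRingType) (n : idealr S) z :
  to_residue n z = 0 <-> z \in n.
Proof.
have r0 : to_residue n 0 = 0.
  by apply: (addrI (to_residue n 0)); rewrite -to_residueD !addr0.
have eqP0 : (z \in n) = (to_residue n z == to_residue n 0).
  by rewrite /to_residue -Quotient.idealrBE subr0.
by rewrite eqP0 r0; split=> /eqP.
Qed.

Lemma residue_field (a : residue (@loc_max R p)) : a != 0 -> exists b, b * a = 1.
Proof.
move=> a0; have [z aE] : exists z, a = to_residue (@loc_max R p) z.
  by exists (repr a); rewrite /to_residue reprK.
have z_notin : z \notin @loc_max R p.
  by apply: contra a0 => /to_residue_eq0 z0; rewrite aE z0.
have [b [s zE]] := loc_fracP z.
have bp : b \notin p.
  by apply: contra z_notin => bp; rewrite inE; exists b, s.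
exists (to_residue _ (loc_frac (val s) (Sub b bp))).
rewrite aE -to_residueM -to_residue1 zE; congr (to_residue _ _).
rewrite -[LHS]/(loc_mul _ _) loc_mulE; apply/frac_eq; exists (denom1 p).
rewrite !SubK; rewrite -[LHS]/(1 * 1 * (val s * b)) -[RHS]/(1 * (b * val s) * 1).
by ring.
Qed.

End LocalizationFunctor.

Section LocalRing.
Variables (R : comNzRingType) (m : prime_idealr R).
Hypotheses (noeth : noetherian R) (loc_m : local_ring m).

(** Otherwise the ideal generated by s is contained in a maximal ideal, which is m. *)
Lemma local_unit s : s \notin m -> exists t, t * s = 1.
Proof.
move=> sm; apply: contrapT => nounit.
pose P := [set A : set R | [/\ is_ideal A, ~ A 1 & A s]].
have [A [[iA A1 As] maxA]] : exists A, P A /\ forall B, P B -> A `<=` B -> B `<=` A.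
  apply: noetherian_max => //; first by move=> A [].
  exists [set a | exists t, a = t * s]; split.
  - apply: subspaceP; first by exists 0; rewrite mul0r.
    by move=> c _ _ [t ->] [u ->]; exists (c * t + u); rewrite mulrDl -mulrA.
  - by move=> [t t1]; apply: nounit; exists t.
  - by exists 1; rewrite mul1r.
have [Q QA] := idealr_of_set iA A1.
have maxQ : maximal_ideal Q.
  move=> N QN x; apply/idP/idP => [Nx|/QN//]; apply/QA.
  apply: (maxA [set y | y \in N]) => //; last by move=> y /QA/QN.
  split; [|by rewrite /= idealr1|by apply/QN/QA].
  apply: subspaceP; first exact: rpred0.
  by move=> c y z Ny Nz; apply: rpredD => //; exact: idealMr.
have [_ /(_ Q maxQ) Qm] := loc_m.
by move: sm; rewrite -Qm => /negP; apply; apply/QA.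
Qed.

Local Notation ofrac x := (frac x (denom1 m)).

(** Since the denominators are units, every module is its own localization. *)
Lemma locP (X : lmodType R) (z : locmod m X) : exists x, z = ofrac x.
Proof.
have [x [s ->]] := fracP z; have [t ts] := local_unit (valP s).
exists (t *: x); apply/frac_eq; exists (denom1 m); rewrite !SubK scalerA.
by congr (_ *: _); rewrite !mul1r mulrC.
Qed.

Lemma loc_ringP (c : loc m) : exists a : R, c = loc_frac a (denom1 m).
Proof. exact: (@locP R^o c). Qed.

Lemma ofrac_eq0 (X : lmodType R) (x : X) : ofrac x = 0 <-> x = 0.
Proof.
split=> [/frac_eq[u]|->//].
rewrite scaler0 SubK mulr1 => ux; have [t tu] := local_unit (valP u).
by rewrite -[x]scale1r -tu -scalerA ux scaler0.
Qed.

Lemma ofracB (X : lmodType R) (x y : X) : ofrac (x - y) = ofrac x - ofrac y.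
Proof.
apply/eqP; rewrite eq_sym subr_eq; apply/eqP; rewrite fracD; apply/frac_eq.
by exists (denom1 m); rewrite !SubK !scale1r subrK !mulr1.
Qed.

Lemma ofrac_inj (X : lmodType R) : injective (fun x : X => ofrac x).
Proof.
move=> x y /= xy; apply/eqP; rewrite -subr_eq0; apply/eqP/ofrac_eq0.
by rewrite ofracB xy subrr.
Qed.

Lemma loc_map_exact (A B C : lmodType R) (f : {linear A -> B}) (g : {linear B -> C}) :
  (forall b, g b = 0 <-> exists a, b = f a) ->
  forall z, loc_map (p := m) g z = 0 <-> exists y, z = loc_map f y.
Proof.
move=> fg z; have [b ->] := locP z; rewrite loc_mapE ofrac_eq0 fg.
split=> [[a ->]|[y]]; first by exists (ofrac a); rewrite loc_mapE.
by have [a ->] := locP y; rewrite loc_mapE => /ofrac_inj ->; exists a.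
Qed.

Lemma loc_map_inj (A B : lmodType R) (f : {linear A -> B}) :
  injective f -> injective (loc_map (p := m) f).
Proof.
move=> f_inj y z; have [a ->] := locP y; have [b ->] := locP z.
by rewrite !loc_mapE => /ofrac_inj/f_inj ->.
Qed.

Section Restriction.
Variable A : lmodType (loc m).

(** Restriction of scalars along R -> R_m. *)
Definition restr : Type := A.

HB.instance Definition _ := GRing.Zmodule.on restr.

Definition restr_scale (a : R) (x : restr) : restr := (loc_frac a (denom1 m) *: (x : A)).

Lemma restr_scaleA a b x : restr_scale a (restr_scale b x) = restr_scale (a * b) x.
Proof.
rewrite /restr_scale scalerA; congr (_ *: (x : A)).
rewrite -[LHS]/(loc_mul _ _) loc_mulE; congr loc_frac; apply: val_inj.
by rewrite !SubK mulr1.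
Qed.

Lemma restr_scale1 : left_id 1 restr_scale.
Proof. by move=> x; exact: (@scale1r (loc m) A x). Qed.

Lemma restr_scaleDr : right_distributive restr_scale +%R.
Proof. by move=> a x y; exact: scalerDr. Qed.

Lemma restr_scaleDl x : {morph restr_scale^~ x : a b / a + b}.
Proof.
move=> a b; rewrite /restr_scale -[RHS](@scalerDl (loc m) A); congr (_ *: _).
by rewrite loc_fracD !mul1r; congr loc_frac; apply: val_inj; rewrite !SubK mulr1.
Qed.

HB.instance Definition _ := GRing.Zmodule_isLmodule.Build R restr
  restr_scaleA restr_scale1 restr_scaleDr restr_scaleDl.

End Restriction.

(** An R_m-linear extension problem into the localization of E is an R-linear one into
E after restriction of scalars, and its R-linear solutions are R_m-linear. *)
Lemma locmod_injective (E : lmodType R) :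
  injective_module E -> injective_module (locmod m E).
Proof.
move=> injE A B i f i_inj.
have i_lin : linear (i : restr A -> restr B).
  by move=> a x y; exact: (linearP i (loc_frac a (denom1 m)) x y).
pose i' : {linear restr A -> restr B} := HB.pack (i : restr A -> restr B)
  (GRing.isLinear.Build _ _ _ _ (i : restr A -> restr B) i_lin).
pose f0 (a : restr A) : E := projT1 (cid (locP (f a))).
have f0E a : f a = ofrac (f0 a) by rewrite /f0; case: cid.
have scE a (x : E) : loc_frac a (denom1 m) *: (ofrac x : locmod m E) = ofrac (a *: x).
  apply: etrans (loc_scaleE a (denom1 m) x (denom1 m)) _; apply/frac_eq.
  by exists (denom1 m); rewrite !SubK !mulr1.
have f0_lin : linear f0.
  move=> a x y; apply: ofrac_inj => /=; rewrite -f0E.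
  have -> : f (a *: x + y) = loc_frac a (denom1 m) *: f x + f y by exact: linearP.
  by rewrite !f0E scE -[RHS](subrK (ofrac (f0 y))) -ofracB addrK.
pose f' : {linear restr A -> E} := HB.pack f0 (GRing.isLinear.Build _ _ _ _ f0 f0_lin).
have [g gE] := @injE (restr A) (restr B) i' f' i_inj.
pose h (b : B) : locmod m E := ofrac (g b).
have h_lin : linear h.
  move=> c x y; have [a ->] := loc_ringP c.
  rewrite /h; have -> : g (loc_frac a (denom1 m) *: x + y) = a *: g x + g y.
    by rewrite -linearP.
  by rewrite scE -[LHS](subrK (ofrac (g y))) -ofracB addrK.
exists (HB.pack h (GRing.isLinear.Build _ _ _ _ h h_lin) : {linear B -> locmod m E}) => a.
by rewrite f0E /= /h; congr frac; exact: gE.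
Qed.

Definition loc_resolution (X : lmodType R) (E : injective_resolution X) :
    injective_resolution (locmod m X) :=
  @InjectiveResolution (loc m) (locmod m X) (fun n => locmod m (res_obj E n))
    (fun n => loc_map (res_d E n)) (loc_map (res_aug E))
    (fun n => locmod_injective (res_inj (i := E) (n := n)))
    (loc_map_inj (@res_aug_inj _ _ E))
    (loc_map_exact (@res_exact0 _ _ E))
    (fun n => loc_map_exact (@res_exact _ _ E n)).

Lemma residue_functor_left_exact : left_exact (residue_functor m).
Proof.
move=> A B C i p i_inj p_ker; have li_inj := loc_map_inj i_inj.
split=> [g h gh|h hp].
  apply: hom_eq => x; apply: li_inj.
  by have := congr1 (fun k => val k x) gh; rewrite !SubK.
have h_im x : exists y, val h x = loc_map i y.
  by apply/(loc_map_exact p_ker); have := congr1 (fun k => val k x) hp; rewrite SubK.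
pose k x := projT1 (cid (h_im x)).
have kE x : val h x = loc_map i (k x) by rewrite /k; case: cid.
have k_hom : k \in @hom_pred _ (@loc_max R m) (locmod m A).
  rewrite inE => c x y; apply: li_inj.
  by rewrite -kE homP !kE linearP.
by exists (Sub k k_hom); apply: hom_eq => x; rewrite SubK kE.
Qed.

(** The chosen resolution of the localization and the localization of a resolution of
X bound the same dimensions. *)
Lemma bass_dim_le (X : lmodType R) (n : nat) :
  ext_le (residue_functor m) n X (bass_number m n X).
Proof.
have [E] := injective_resolution_exists X; exists E.
rewrite /bass_number /Ext_residue /right_derived.
case: pselect => [e|[]]; last exact: (squash (loc_resolution E)).
have := @dimension_dim_le _ (@residue_field _ m)
  (applied_cohomology (hom_functor (@loc_max R m)) (unsquash e) n) [set 0].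
move=> /(applied_cohomologyP (@residue_field _ m)).
move=> /(@coh_le_retract _ _ (@residue_field _ m) (hom_functor (@loc_max R m)) _ _
   idfun idfun (fun=> erefl) (loc_resolution E) (unsquash e) n).
by [].
Qed.

Lemma bass_le_dim (X : lmodType R) (n : nat) T :
  ext_le (residue_functor m) n X T -> cardinal_le (bass_number m n X) T.
Proof.
move=> [E ET]; rewrite /bass_number /Ext_residue /right_derived.
case: pselect => [e|[]]; last exact: (squash (loc_resolution E)).
apply: (@dim_le_dimension _ (@residue_field _ m) _ [set 0]) => //.
apply/(applied_cohomologyP (@residue_field _ m)).
exact: (@coh_le_retract _ _ (@residue_field _ m) (hom_functor (@loc_max R m)) _ _
   idfun idfun (fun=> erefl) (unsquash e) (loc_resolution E) n).
Qed.

End LocalRing.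

(** * Bass numbers of local cohomology modules *)
Section Torsion.
Variables (R : comNzRingType) (m : prime_idealr R) (I J : ideal R).
Hypotheses (noeth : noetherian R) (loc_m : local_ring m).

Lemma proper_sub_max (A : ideal R) x : 1 \notin A -> x \in A -> x \in m.
Proof.
move=> A1 Ax; apply: contrapT => /negP/(local_unit noeth loc_m)[t tx].
by case/negP: A1; rewrite -tx; exact: (@rpredZ _ _ A t x).
Qed.

(** When I is proper it is contained in m. When it is not, neither is J. *)
Lemma W_above_max (p : prime_idealr R) :
  (1 \in I -> 1 \in J) -> {subset m <= p} -> W I J p.
Proof.
move=> IJ mp; exists 1%N => // x [k [c [f [fI ->]]]].
case: (boolP (1 \in I)) => [/IJ J1|I1].
  exists (\sum_(i < k) c i * \prod_j f i j), 0; rewrite addr0 rpred0; split=> //.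
  by rewrite -[X in X \in _]mulr1; exact: (@rpredZ _ _ J).
exists 0, (\sum_(i < k) c i * \prod_j f i j); rewrite add0r rpred0; split=> //.
apply: rpred_sum => i _; apply: idealMr; rewrite big_ord1.
exact/mp/(proper_sub_max I1)/fI.
Qed.

Lemma W_max_unit : 1 \in I -> W I J m -> 1 \in J.
Proof.
move=> I1 [n _ Wm]; have [|a [b [aJ bm E]]] := Wm 1.
  exists 1%N, (fun=> 1), (fun _ _ => 1); split=> //.
  by rewrite big_ord1 mul1r big1.
apply: contrapT => /negP J1; have := idealr1 m.
by rewrite E rpredD // (proper_sub_max J1 aJ).
Qed.

(** If I is the unit ideal and J is proper, then W I J consists of the primes p with
J + p = R, and there are none in a local ring. *)
Lemma Gamma_zero (M : lmodType R) : 1 \in I -> 1 \notin J ->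
  forall x : Gamma I J M, x = 0.
Proof.
move=> I1 /negP J1 x; apply: val_inj; apply: contrapT => x0; apply/J1/W_max_unit => //.
apply: (iffLR (GammaP I J (val x)) (valP x)) => a ax.
apply: contrapT => /negP/(local_unit noeth loc_m)[t ta]; apply: x0.
by rewrite -[val x]scale1r -ta -scalerA ax scaler0.
Qed.

(** An element in the image of a map k -> E_m is killed by m, so its support is
contained in {m}, which lies in W I J; hence the map factors through the torsion. *)
Lemma Gamma_residue_bijective (E : lmodType R) : (1 \in I -> 1 \in J) ->
  forall v : {linear Gamma I J E -> E}, v =1 val ->
  injective (fmap (residue_functor m) v) /\
  forall h, exists g, h = fmap (residue_functor m) v g.
Proof.
move=> IJ v vE; have v_inj : injective v by move=> x y; rewrite !vE => /val_inj.
have [Gv_inj Gv_ker] := residue_functor_left_exact noeth loc_m v_inj (to_coker_eq0 v).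
split=> // h; apply: Gv_ker; apply: hom_eq => c; rewrite SubK /=.
have [x xE] := locP noeth loc_m (val h c); rewrite xE loc_mapE.
suff -> : to_coker v x = 0 by [].
have xG : x \in @Gamma_pred R I J E.
  apply/GammaP => p px; apply: (W_above_max IJ) => a am; apply: px.
  apply/(ofrac_eq0 noeth loc_m).
  have -> : frac (a *: x) (denom1 m) = loc_frac a (denom1 m) *: (frac x (denom1 m) : locmod m E).
    apply: etrans _ (esym (loc_scaleE a (denom1 m) x (denom1 m))).
    by apply/frac_eq; exists (denom1 m); rewrite !SubK !mulr1.
  rewrite -xE; have ac0 : loc_frac a (denom1 m) *: c = 0.
    rewrite residue_scaleE (_ : to_residue _ _ = 0) ?mul0r //.
    by apply/to_residue_eq0; rewrite inE; exists a, (denom1 m).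
  have h0 : val h 0 = 0.
    by have := homP h (-1) 0 0; rewrite scaler0 addr0 scaleN1r addNr.
  have := homP h (loc_frac a (denom1 m)) c 0.
  by rewrite addr0 ac0 h0 addr0 => <-.
by apply/to_coker_eq0; exists (exist _ x xG); rewrite vE.
Qed.

End Torsion.

Section ComplexIso.
Variables (R K : comNzRingType).
Hypothesis fieldK : forall a : K, a != 0 -> exists b, b * a = 1.
Variable G : additive_functor R K.
Variables (C D : nat -> lmodType R).
Variables (dC : forall n, {linear C n -> C n.+1}) (dD : forall n, {linear D n -> D n.+1}).
Variable v : forall n, {linear C n -> D n}.
Hypothesis dv : forall n x, v n.+1 (dC n x) = dD n (v n x).
Hypothesis v_inj : forall n, injective (fmap G (v n)).
Hypothesis v_surj : forall n h, exists g, h = fmap G (v n) g.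

Lemma coh_le_iso n T : coh_le G dC n T <-> coh_le G dD n T.
Proof.
have Gdv k x : fmap G (v k.+1) (fmap G (dC k) x) = fmap G (dD k) (fmap G (v k) x).
  exact: fmapE_square.
have cyc k z : cycles (fmap G (dC k)) z <-> cycles (fmap G (dD k)) (fmap G (v k) z).
  rewrite /cycles /= -Gdv; split=> [->|]; first by rewrite linear0.
  exact: linear_inj0.
split; case: n => [|n] dT.
- apply: (dim_le_quot (alpha := fmap G (v 0))) dT.
  + exact: subspace_boundaries.
  + by move=> z /cyc.
  + by move=> _ [u ->]; exists 0; rewrite !linear0.
  + move=> z; have [g ->] := v_surj z => /cyc zc; exists g; split=> //.
    by exists 0; rewrite subrr linear0.
- apply: (dim_le_quot (alpha := fmap G (v n.+1))) dT.
  + exact: subspace_boundaries.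
  + by move=> z /cyc.
  + by move=> _ [u ->]; exists (fmap G (v n) u); rewrite Gdv.
  + move=> z; have [g ->] := v_surj z => /cyc zc; exists g; split=> //.
    by exists 0; rewrite subrr linear0.
- apply: (dim_le_sub fieldK (beta := fmap G (v 0))) dT.
  + exact: subspace_cycles.
  + exact: subspace_boundaries.
  + exact: subspace_boundaries.
  + by move=> z /cyc.
  + by move=> z _ [u /(linear_inj0 (@v_inj 0)) ->]; exists 0; rewrite linear0.
- apply: (dim_le_sub fieldK (beta := fmap G (v n.+1))) dT.
  + exact: subspace_cycles.
  + exact: subspace_boundaries.
  + exact: subspace_boundaries.
  + by move=> z /cyc.
  + by move=> z _ [u]; have [g ->] := v_surj u; rewrite -Gdv => /v_inj ->; exists g.
Qed.

End ComplexIso.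

Section BassNumbers.
Variables (R : comNzRingType) (m : prime_idealr R) (I J : ideal R).
Hypotheses (noeth : noetherian R) (loc_m : local_ring m).

Lemma bass_number_neg (X : lmodType R) (s : nat) T :
  cardinal_le (bass_number m (Negz s) X) T.
Proof.
have void_inj : injective (fun v : void => match v with end : T) by case.
apply: (@dim_le_dimension _ (@residue_field _ m) _ [set 0]) => //.
apply: (dim_le_inj _ void_inj) => //.
exists (fun v : void => match v with end); split=> [[]|y _].
by rewrite [y](thinmx0 y); exact: span0.
Qed.

Lemma bass_number_zero (X : lmodType R) (s : int) T :
  (forall x : X, x = 0) -> cardinal_le (bass_number m s X) T.
Proof.
move=> X0; have void_inj : injective (fun v : void => match v with end : T) by case.
case: s => [s|s]; last exact: bass_number_neg.
apply: (bass_le_dim noeth loc_m); apply: (ext_le_inj void_inj).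
exact: ext_le_zero.
Qed.

(** Local cohomology is that of the complex of torsion submodules of one resolution
E, which is the same one in all degrees. *)
Lemma local_cohomology_complex (M : lmodType R) : exists E : injective_resolution M,
  forall n : nat, local_cohomology I J n M
    = Hmod (fun k => @Gamma_map R I J _ _ (res_d E k) : {linear Gamma I J _ -> Gamma I J _}) n.
Proof.
have [E0] := injective_resolution_exists M.
case: (pselect $|injective_resolution M|) => [e|[]]; last exact: squash E0.
exists (unsquash e) => n; rewrite /local_cohomology /right_derived.
case: pselect => [e'|//]; rewrite (Prop_irrelevance e' e).
by case: n.
Qed.

End BassNumbers.

Theorem corollary2p4 (R : comNzRingType) (m : prime_idealr R) (I J : ideal R)
    (M : lmodType R) (s t : int) :
  noetherian R -> local_ring m ->
  let mu (j : int) (X : lmodType R) := bass_number m j X in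
  let H (i : int) := local_cohomology I J i M in
  ((1 \in I -> 1 \in J) ->
   cardinal_le (mu t M) (cardinal_sum 0 t (fun i => mu (t - i) (H i)))) /\
  cardinal_le (mu s (H t))
    (cardinal_sum 0 (t - 1) (fun i => mu (s + t + 1 - i)%R (H i)) +
     mu (s + t)%R M +
     cardinal_sum (t + 1) (s + t - 1) (fun i => mu (s + t - 1 - i)%R (H i)))%type.
Proof.
move=> noeth loc_m mu H.
have [E HE] := local_cohomology_complex I J M.
pose C n : lmodType R := Gamma I J (res_obj E n).
pose d n : {linear C n -> C n.+1} := @Gamma_map R I J _ _ (res_d E n).
have dd0 n x : d n.+1 (d n x) = 0.
  by apply: val_inj; apply/(res_exact (i := E)); exists (val x).
have injC n : injective_module (C n) by exact: Gamma_injective (res_inj (i := E) (n := n)).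
have fieldK := @residue_field R m.
have lexG := residue_functor_left_exact noeth loc_m.
pose v n : {linear C n -> res_obj E n} := val.
have HmodE (n : nat) : H n = Hmod d n := HE n.
have coh_iso (IJ : 1 \in I -> 1 \in J) (n : nat) T :
    coh_le (residue_functor m) d n T <-> coh_le (residue_functor m) (res_d E) n T.
  by apply: (coh_le_iso fieldK (v := v)) => // k;
     have [] := Gamma_residue_bijective noeth loc_m IJ (v := v k).
have ext_H (i r : nat) : ext_le (residue_functor m) r (Hmod d i) (mu r (H i)).
  by rewrite -HmodE; exact: bass_dim_le.
split=> [IJ|].
  case: t => t; last exact: bass_number_neg.
  apply: (bass_le_dim noeth loc_m); exists E; apply/(coh_iso IJ).
  apply: coh_le_total => // i r rit; rewrite (_ : t%:Z - i%:Z = r) //; lia.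
case: t => t; last first.
  by apply: bass_number_zero => // x; exact: (thinmx0 x).
case: s => s; last exact: bass_number_neg.
case: (pselect (1 \in I -> 1 \in J)) => [IJ|nIJ]; last first.
  have [I1 J1] : 1 \in I /\ 1 \notin J.
    by case: (boolP (1 \in I)) nIJ => [|_ []//]; case: (boolP (1 \in J)) => // _ _ [].
  apply: bass_number_zero => // x; move: x; rewrite HmodE => x.
  have [z ->] := to_quotP x; apply/to_quot_eq0.
  suff -> : z = 0 by exact: rpred0.
  by apply: val_inj; exact: (Gamma_zero noeth loc_m I1 J1).
apply: (bass_le_dim noeth loc_m); rewrite HmodE.
apply: (ext_le_H fieldK lexG dd0 injC).
- by apply/(coh_iso IJ)/(ext_leP fieldK)/bass_dim_le.
- by move=> i r rist; rewrite (_ : s%:Z + t%:Z + 1 - i%:Z = r) //; lia.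
- by move=> i r rist; rewrite (_ : s%:Z + t%:Z - 1 - i%:Z = r) //; lia.
Qed.
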